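(* In the setting described in the context, for each $0\le m\le n-2$ the pair of invariant subbundles $(W_{0,m}(Y),W_{m+1,n-1}(Y))$ is exponentially separated for the linear skew-product flow $\pi(t,x,y)=(\Phi(t,y)x,y\cdot t)$ on $\mathbb{R}^n\times Y$; that is, there exist $K>0$ and $\nu>0$ such that $$\frac{|\Phi(t,y)x_2|}{|\Phi(t,y)x_1|}\le Ke^{-\nu t},\qquad t\ge 0,$$ for all $y\in Y$, $x_1\in W_{0,m}(y)$, $x_2\in W_{m+1,n-1}(y)$ with $|x_1|=|x_2|=1$.
   Context: Let $(Y,d)$ be a compact metric space with a continuous flow $(y,t)\mapsto y\cdot t$, and $B:Y\to\mathbb{R}^{n\times n}$ continuous with each $B(y)$ tridiagonal and $b_{i,i+1}(y)>0$, $b_{i+1,i}(y)>0$ for all $y$ and $1\le i\le n-1$. Consider $\dot x=B(y\cdot t)x$ with principal fundamental matrix $\Phi(t,y)$. Let $\Lambda=\{x\in\mathbb{R}^n: x_1\ne0,\ x_n\ne0,\ \text{and if } x_i=0 \text{ for some } 2\le i\le n-1 \text{ then } x_{i-1}x_{i+1}<0\}$ and $\sigma(x)=\#\{i: x_i=0 \text{ or } x_ix_{i+1}<0\}$ for $x\in\Lambda$. For $0\le l\le m\le n-1$, $W_{l,m}(y)$ is the set of $x\ne 0$ such that the solution $x(t)$ of $\dot x=B(y\cdot t)x$, $x(0)=x$, satisfies $l\le\sigma(x(t))\le m$ whenever $x(t)\in\Lambda$, together with $0$; it is a linear subspace of dimension $m-l+1$, and $W_{l,m}(Y)=\bigcup_{y\in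 Y}W_{l,m}(y)\times\{y\}$. *)

(* Defs.v *)
(* classical reals. Vectors of R^n are functions nat -> R,
   only the indices 0..n-1 are used (0-based: paper's x_i is x (i-1)). *)
From Stdlib Require Import Reals Lra Lia List.
Open Scope R_scope.

Definition is_metric {Y : Type} (d : Y -> Y -> R) : Prop :=
  (forall x y, 0 <= d x y) /\
  (forall x y, d x y = 0 <-> x = y) /\
  (forall x y, d x y = d y x) /\
  (forall x y z, d x z <= d x y + d y z).

Definition is_open {Y : Type} (d : Y -> Y -> R) (U : Y -> Prop) : Prop :=
  forall y, U y -> exists r, 0 < r /\ forall z, d y z < r -> U z.

Definition is_compact {Y : Type} (d : Y -> Y -> R) : Prop :=
  forall (I : Type) (U : I -> Y -> Prop),
    (forall i, is_open d (U i)) ->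
    (forall y, exists i, U i y) ->
    exists l : list I, forall y, exists i, In i l /\ U i y.

Definition is_continuous_flow {Y : Type} (d : Y -> Y -> R) (fl : Y -> R -> Y) : Prop :=
  (forall y, fl y 0 = y) /\
  (forall y s t, fl (fl y s) t = fl y (s + t)) /\
  (forall y t eps, 0 < eps -> exists delta, 0 < delta /\
     forall y' t', d y y' < delta -> Rabs (t' - t) < delta ->
       d (fl y t) (fl y' t') < eps).

Definition is_continuous_fun {Y : Type} (d : Y -> Y -> R) (f : Y -> R) : Prop :=
  forall y eps, 0 < eps -> exists delta, 0 < delta /\
    forall y', d y y' < delta -> Rabs (f y' - f y) < eps.

Fixpoint sumn (n : nat) (f : nat -> R) : R :=
  match n with O => 0 | S k => sumn k f + f k end.

Definition mat_vec (n : nat) (A : nat -> nat -> R) (x : nat -> R) : nat -> R :=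
  fun i => sumn n (fun j => A i j * x j).

Definition vnorm (n : nat) (x : nat -> R) : R := sqrt (sumn n (fun i => x i ^ 2)).

Definition tridiag_pos (n : nat) (M : nat -> nat -> R) : Prop :=
  (forall i j, (i < n)%nat -> (j < n)%nat -> (S i < j \/ S j < i)%nat -> M i j = 0) /\
  (forall i, (S i < n)%nat -> 0 < M i (S i) /\ 0 < M (S i) i).

Definition principal_fundamental_matrix {Y : Type} (n : nat) (fl : Y -> R -> Y)
  (B : Y -> nat -> nat -> R) (Phi : R -> Y -> nat -> nat -> R) : Prop :=
  (forall y i j, (i < n)%nat -> (j < n)%nat ->
     Phi 0 y i j = if Nat.eqb i j then 1 else 0) /\
  (forall y i j t, (i < n)%nat -> (j < n)%nat ->
     derivable_pt_lim (fun s => Phi s y i j) t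
       (sumn n (fun k => B (fl y t) i k * Phi t y k j))).

(* paper (1-based): x_1 <> 0, x_n <> 0, and x_i = 0 (2<=i<=n-1) -> x_{i-1} x_{i+1} < 0 *)
Definition in_Lambda (n : nat) (x : nat -> R) : Prop :=
  x 0%nat <> 0 /\ x (n - 1)%nat <> 0 /\
  (forall i, (1 <= i)%nat -> (i <= n - 2)%nat -> x i = 0 -> x (i - 1)%nat * x (S i) < 0).

(* sigma(x) = #{ i in 1..n-1 : x_i = 0 or x_i x_{i+1} < 0 } (1-based),
   i.e. indices 0..n-2 in 0-based form *)
Definition sc_indicator (x : nat -> R) (i : nat) : nat :=
  if Req_EM_T (x i) 0 then 1%nat
  else if Rlt_dec (x i * x (S i)) 0 then 1%nat else 0%nat.

Fixpoint count_upto (k : nat) (f : nat -> nat) : nat :=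
  match k with O => O | S k' => (count_upto k' f + f k')%nat end.

Definition sigma (n : nat) (x : nat -> R) : nat := count_upto (n - 1) (sc_indicator x).

Definition in_W {Y : Type} (n : nat) (Phi : R -> Y -> nat -> nat -> R) (l m : nat) (y : Y)
  (x : nat -> R) : Prop :=
  (forall i, (i < n)%nat -> x i = 0) \/
  (forall t : R, in_Lambda n (mat_vec n (Phi t y) x) ->
     (l <= sigma n (mat_vec n (Phi t y) x) <= m)%nat).

(* Main.v *)
From Stdlib Require Import Reals Lra Lia Arith List Classical ClassicalEpsilon.
Require Coquelicot.Compactness.
Require Import Defs.
Open Scope R_scope.

(* Near a time [t0] a component of a nonzero solution is governed by its first
   nonvanishing Taylor coefficient, a positive combination of the nearest
   nonzero components of [x t0].  Hence solutions lie in Lambda except at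
   isolated times, and [sigma] does not increase in time.

   Let [u], [v] be solutions in [W_{0,m}] and [W_{m+1,n-1}], and let [rho] be
   the ratio [|v|^2 / |u|^2].  A combination [u + c v] has at most [m] sign
   changes where [u] dominates and more than [m] where [v] dominates, so
   monotonicity of [sigma] and compactness give [rho t <= M rho s] for
   [t >= s + 2].  If [rho] were not halved within a uniform time, a limit
   along the flow would produce a pair with [rho] bounded away from [0] and
   infinity on the whole line.  In a further limit [t -> -oo] every combination
   of that pair has a constant number of sign changes; being locally constant
   in the combination it is the same for [u] and [v], which is absurd. *)

(** * Sign patterns *)

(** The leading coefficient at a vanishing node is inconclusive when its nearest nonzero nodes are
    equidistant with opposite signs. Such a node is the midpoint of a run of zeros; its two
    neighbours are each closer to a different end, so they take opposite signs, and the count across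
    the node is one whatever its own sign becomes. Adjacent nodes whose orders of vanishing differ
    by one have opposite signs just before [t0] and equal signs just after: this is where [sigma]
    drops.

    As [sigma] gives information only in Lambda, every comparison moves to a nearby time at which
    the state lies in Lambda. The delay [2] in the bound on [rho] leaves one unit of time for this
    at each end.

    The second limit is there because along the first limit pair [sigma] may still drop, so values
    taken at different times cannot be compared. Backward in time [sigma] is monotone and bounded by
    [n], hence eventually constant, and the limit orbit sees only this final value. Two combinations
    can then be compared at any one time. *)

(* Shifting the indices by one and padding with zeros removes the boundary
   cases: with [Z = pad n x], membership in Lambda is the single condition
   "[Z i = 0 -> Z (i - 1) * Z (i + 1) < 0] for [1 <= i <= n]", and truncated
   subtraction lands on the index [0], where [Z] vanishes. *)
Definition pad (n : nat) (x : nat -> R) (i : nat) : R :=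
  match i with O => 0 | S j => if Nat.ltb j n then x j else 0 end.

Lemma pad_S n x j : (j < n)%nat -> pad n x (S j) = x j.
Proof. intros H; simpl; destruct (Nat.ltb_spec j n); [reflexivity | lia]. Qed.

Lemma pad_gt n x i : (n < i)%nat -> pad n x i = 0.
Proof.
  intros H; destruct i; simpl; [lia |].
  destruct (Nat.ltb_spec i n); [lia | reflexivity].
Qed.

Lemma in_Lambda_pad n x : (2 <= n)%nat ->
  (in_Lambda n x <->
   forall i, (1 <= i <= n)%nat -> pad n x i = 0 -> pad n x (i - 1) * pad n x (S i) < 0).
Proof.
  intros Hn; split.
  - intros (H0 & H1 & H2) i Hi E.
    destruct i as [|i]; [lia |].
    rewrite pad_S in E by lia.
    destruct (Nat.eq_dec i 0) as [->|Hi0]; [contradiction |].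
    destruct (Nat.eq_dec i (n - 1)) as [->|Hi1]; [contradiction |].
    specialize (H2 i ltac:(lia) ltac:(lia) E).
    replace (S i - 1)%nat with (S (i - 1)) by lia.
    rewrite !pad_S by lia; exact H2.
  - intros H; repeat split.
    + intros E; specialize (H 1%nat ltac:(lia)).
      rewrite pad_S in H by lia; specialize (H E); simpl in H; lra.
    + intros E; specialize (H (S (n - 1))%nat ltac:(lia)).
      rewrite pad_S in H by lia; specialize (H E).
      rewrite (pad_gt n x (S (S (n - 1)))) in H by lia; lra.
    + intros i Hi1 Hi2 E; specialize (H (S i) ltac:(lia)).
      rewrite pad_S in H by lia; specialize (H E).
      replace (S i - 1)%nat with (S (i - 1)) in H by lia.
      rewrite !pad_S in H by lia; exact H.
Qed.

(** Vanishing at distance less than [k] from [i], written with sums because subtraction on [nat]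
    truncates. *)
Definition zero_radius (Z : nat -> R) (i k : nat) : Prop :=
  forall j, (i < j + k)%nat -> (j < i + k)%nat -> Z j = 0.

(* [Z] is the state of a solution at some time [t0]; the node [i] leaves or
   enters its value [Z i] like [(a * Z (i - k) + b * Z (i + k)) * h ^ k] with
   [a, b > 0].  [follows n Z e U] says that [U] has the signs of a state at
   [t0 + h], [h] small with sign [e], wherever this leading term decides it. *)
Definition follows (n : nat) (Z : nat -> R) (e : R) (U : nat -> R) : Prop :=
  forall i k, (1 <= i <= n)%nat -> zero_radius Z i k ->
    0 <= Z (i - k)%nat * Z (i + k)%nat -> Z (i - k)%nat + Z (i + k)%nat <> 0 ->
    0 < (Z (i - k)%nat + Z (i + k)%nat) * e ^ k * U i.

(** Here [k] is the distance to the nearest nonzero node, and every positive combination of the two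
    end values has the sign of their sum. For [k = 0] the condition reduces to [Z i <> 0]. *)
Definition decided (Z : nat -> R) (i k : nat) : Prop :=
  zero_radius Z i k /\ 0 <= Z (i - k)%nat * Z (i + k)%nat /\
  Z (i - k)%nat + Z (i + k)%nat <> 0.

Definition undecided (Z : nat -> R) (i k : nat) : Prop :=
  zero_radius Z i k /\ Z (i - k)%nat * Z (i + k)%nat < 0.

Lemma follows_decided n Z e U i k : follows n Z e U -> decided Z i k ->
  (1 <= i <= n)%nat -> 0 < (Z (i - k)%nat + Z (i + k)%nat) * e ^ k * U i.
Proof. intros F (H1 & H2 & H3) Hi; apply F; assumption. Qed.

Lemma decided_or_undecided n Z i :
  (exists j, (1 <= j <= n)%nat /\ Z j <> 0) -> (1 <= i <= n)%nat ->
  exists k, decided Z i k \/ undecided Z i k.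
Proof.
  intros (j & Hj & Zj) Hi.
  assert (Hmin : forall k, zero_radius Z i k \/
     exists k', zero_radius Z i k' /\ (Z (i - k')%nat <> 0 \/ Z (i + k')%nat <> 0)).
  { induction k as [|k [IH|IH]].
    - left; intros a; lia.
    - destruct (Req_EM_T (Z (i - k)%nat) 0) as [E1|E1];
        [destruct (Req_EM_T (Z (i + k)%nat) 0) as [E2|E2] |].
      + left; intros a Ha Hb.
        destruct (Nat.eq_dec a (i - k)) as [->|]; [exact E1 |].
        destruct (Nat.eq_dec a (i + k)) as [->|]; [exact E2 |].
        apply IH; lia.
      + right; exists k; auto.
      + right; exists k; auto.
    - right; exact IH. }
  destruct (Hmin (S (i + j))) as [H|(k & Hk & H)].
  - exfalso; apply Zj, H; lia.
  - exists k; unfold decided, undecided.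
    destruct (Rlt_dec (Z (i - k)%nat * Z (i + k)%nat) 0); [right; auto |].
    left; repeat split; [assumption | lra | nra].
Qed.

Section Signs.

Variables (n : nat) (Z : nat -> R).
Hypothesis Z0 : Z 0%nat = 0.
Hypothesis Zn : forall i, (n < i)%nat -> Z i = 0.
Hypothesis Znz : exists j, (1 <= j <= n)%nat /\ Z j <> 0.

(** Each neighbour of the midpoint of a run of zeros is one step closer to its own end, and the
    other end is out of reach at that distance; so one end alone decides its sign. The padding zeros
    keep both ends within [1..n]. *)
Lemma undecided_neighbours i k : (1 <= i <= n)%nat -> undecided Z i k ->
  exists k', k = S k' /\ (2 <= i)%nat /\ (S i <= n)%nat /\
    decided Z (i - 1) k' /\ decided Z (S i) k' /\
    (Z (i - 1 - k')%nat + Z (i - 1 + k')%nat) * (Z (S i - k')%nat + Z (S i + k')%nat) < 0.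
Proof.
  intros Hi (H1 & H2).
  destruct k as [|k'].
  { rewrite Nat.add_0_r, Nat.sub_0_r in H2; nra. }
  assert (A1 : Z (i - S k')%nat <> 0) by nra.
  assert (A2 : Z (i + S k')%nat <> 0) by nra.
  assert (B1 : (1 <= i - S k')%nat).
  { destruct (i - S k')%nat eqn:E; [rewrite Z0 in A1; lra | lia]. }
  assert (B2 : (i + S k' <= n)%nat).
  { apply NNPP; intros E; apply A2, Zn; lia. }
  exists k'; split; [reflexivity |]; split; [lia |]; split; [lia |].
  replace (i - S k')%nat with (i - 1 - k')%nat in * by lia.
  replace (i + S k')%nat with (S i + k')%nat in * by lia.
  (* For [k' = 0] the neighbour is itself the end of the run and both terms of the sum are the same
     entry; for larger [k'] the inner term lies in the run. *)
  assert (C1 : Z (i - 1 + k')%nat = 0 \/ Z (i - 1 + k')%nat = Z (i - 1 - k')%nat).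
  { destruct k'; [right; f_equal; lia | left; apply H1; lia]. }
  assert (C2 : Z (S i - k')%nat = 0 \/ Z (S i - k')%nat = Z (S i + k')%nat).
  { destruct k'; [right; f_equal; lia | left; apply H1; lia]. }
  unfold decided; repeat split.
  - intros j Hj1 Hj2; apply H1; lia.
  - destruct C1 as [->| ->]; nra.
  - destruct C1 as [->| ->]; lra.
  - intros j Hj1 Hj2; apply H1; lia.
  - destruct C2 as [->| ->]; nra.
  - destruct C2 as [->| ->]; lra.
  - set (a := Z (i - 1 - k')%nat) in *; set (b := Z (S i + k')%nat) in *.
    destruct C1 as [->| ->], C2 as [->| ->]; ring_simplify; lra.
Qed.

(** Both neighbours vanish to the same order [k'], so the time direction enters only as
    [e ^ k' * e ^ k' = 1]. *)
Lemma undecided_sign_change e U i k : e * e = 1 -> follows n Z e U ->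
  (1 <= i <= n)%nat -> undecided Z i k -> U (i - 1)%nat * U (S i) < 0.
Proof.
  intros He F Hi Hu.
  destruct (undecided_neighbours i k Hi Hu) as (k' & _ & Hi1 & Hi2 & D1 & D2 & S12).
  pose proof (follows_decided _ _ _ _ _ _ F D1 ltac:(lia)) as P1.
  pose proof (follows_decided _ _ _ _ _ _ F D2 ltac:(lia)) as P2.
  set (s1 := Z (i - 1 - k')%nat + Z (i - 1 + k')%nat) in *.
  set (s2 := Z (S i - k')%nat + Z (S i + k')%nat) in *.
  assert (E : e ^ k' * e ^ k' = 1) by (rewrite <- Rpow_mult_distr, He, pow1; reflexivity).
  pose proof (Rmult_lt_0_compat _ _ P1 P2) as P.
  replace (s1 * e ^ k' * U (i - 1)%nat * (s2 * e ^ k' * U (S i)))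
    with ((e ^ k' * e ^ k') * ((s1 * s2) * (U (i - 1)%nat * U (S i)))) in P by ring.
  rewrite E in P; nra.
Qed.

(** A decided node has left zero, so a zero of [U] can only sit at an undecided node, whose
    neighbours have opposite signs. *)
Lemma follows_Lambda e U : e * e = 1 -> follows n Z e U ->
  forall i, (1 <= i <= n)%nat -> U i = 0 -> U (i - 1)%nat * U (S i) < 0.
Proof.
  intros He F i Hi E.
  destruct (decided_or_undecided n Z i Znz Hi) as (k & [D|D]).
  - pose proof (follows_decided _ _ _ _ _ _ F D Hi) as P; rewrite E in P; lra.
  - exact (undecided_sign_change e U i k He F Hi D).
Qed.

(* Going up by one in the order of vanishing means having the same nearest
   nonzero node, hence the same leading sign. *)
Lemma decided_edge i k k' : (1 <= i)%nat -> (S i <= n)%nat ->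
  decided Z i k -> decided Z (S i) k' ->
  k = k' \/
  (k' = S k \/ k = S k') /\
  0 < (Z (i - k)%nat + Z (i + k)%nat) * (Z (S i - k')%nat + Z (S i + k')%nat).
Proof.
  intros H1 H2 (A1 & A2 & A3) (B1 & B2 & B3).
  assert (C1 : (k' <= S k)%nat).
  { apply NNPP; intros C.
    rewrite (B1 (i + k)%nat) in A3 by lia.
    destruct (le_lt_dec k i).
    - rewrite (B1 (i - k)%nat) in A3 by lia; lra.
    - replace (i - k)%nat with 0%nat in A3 by lia; lra. }
  assert (C2 : (k <= S k')%nat).
  { apply NNPP; intros C.
    rewrite (A1 (S i + k')%nat) in B3 by lia.
    destruct (le_lt_dec k' (S i)).
    - rewrite (A1 (S i - k')%nat) in B3 by lia; lra.
    - replace (S i - k')%nat with 0%nat in B3 by lia; lra. }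
  destruct (Nat.eq_dec k k') as [|Hk]; [left; assumption | right].
  assert (C : k' = S k \/ k = S k') by lia.
  split; [exact C |].
  destruct C as [->| ->].
  - replace (S i - S k)%nat with (i - k)%nat in * by lia.
    assert (D : Z (i + k)%nat = 0 \/ Z (i + k)%nat = Z (i - k)%nat).
    { destruct k; [right; f_equal; lia | left; apply B1; lia]. }
    destruct D as [D|D]; rewrite D in *; nra.
  - replace (i + S k')%nat with (S i + k')%nat in * by lia.
    assert (D : Z (S i - k')%nat = 0 \/ Z (S i - k')%nat = Z (S i + k')%nat).
    { destruct k'; [right; f_equal; lia | left; apply A1; lia]. }
    destruct D as [D|D]; rewrite D in *; nra.
Qed.

(** The condition [f = 1 \/ e = f] says that [V] is not on a later side of [t0] than [U]. If the two
    orders agree, the powers of [e] and of [f] square to one and the edge behaves alike on both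
    sides. If they differ by one, the leading signs agree, and the edge has no sign change after
    [t0]. *)
Lemma follows_edge f e U V i k k' : f = 1 \/ f = -1 -> e = 1 \/ e = -1 ->
  f = 1 \/ e = f -> follows n Z f U -> follows n Z e V ->
  (1 <= i)%nat -> (S i <= n)%nat -> decided Z i k -> decided Z (S i) k' ->
  U i * U (S i) < 0 -> V i * V (S i) < 0.
Proof.
  intros Hf He Hfe FU FV H1 H2 D D' HU.
  pose proof (follows_decided _ _ _ _ _ _ FU D ltac:(lia)) as P1.
  pose proof (follows_decided _ _ _ _ _ _ FU D' ltac:(lia)) as P2.
  pose proof (follows_decided _ _ _ _ _ _ FV D ltac:(lia)) as Q1.
  pose proof (follows_decided _ _ _ _ _ _ FV D' ltac:(lia)) as Q2.
  pose proof (decided_edge i k k' H1 H2 D D') as K.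
  set (s1 := Z (i - k)%nat + Z (i + k)%nat) in *.
  set (s2 := Z (S i - k')%nat + Z (S i + k')%nat) in *.
  pose proof (Rmult_lt_0_compat _ _ P1 P2) as P.
  pose proof (Rmult_lt_0_compat _ _ Q1 Q2) as Q.
  assert (Pow : forall a q, a = 1 \/ a = -1 -> a ^ q * a ^ q = 1).
  { intros a q Ha; rewrite <- Rpow_mult_distr.
    replace (a * a) with 1 by (destruct Ha as [->| ->]; ring); apply pow1. }
  replace (s1 * f ^ k * U i * (s2 * f ^ k' * U (S i)))
    with ((f ^ k * f ^ k') * (s1 * s2) * (U i * U (S i))) in P by ring.
  replace (s1 * e ^ k * V i * (s2 * e ^ k' * V (S i)))
    with ((e ^ k * e ^ k') * (s1 * s2) * (V i * V (S i))) in Q by ring.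
  destruct Hfe as [->| ->].
  - rewrite !pow1 in P.
    destruct K as [->|[[->| ->] K]].
    + rewrite (Pow e) in Q by assumption; nra.
    + nra.
    + nra.
  - apply Rnot_le_lt; intros HV. nra.
Qed.

(** The middle entry may have any sign. If it is zero, the product before it is not negative and the
    clause [x i = 0] of the count supplies the one change. *)
Lemma sc_indicator_pair W i : W (S (S i)) <> 0 -> W i <> 0 -> W i * W (S (S i)) < 0 ->
  (sc_indicator W i + sc_indicator W (S i) = 1)%nat.
Proof.
  intros H2 H0 H; unfold sc_indicator.
  destruct (Req_EM_T (W i) 0); [contradiction |].
  destruct (Req_EM_T (W (S i)) 0) as [E|E].
  - rewrite E; destruct (Rlt_dec (W i * 0) 0); [lra | reflexivity].
  - destruct (Rlt_dec (W i * W (S i)) 0), (Rlt_dec (W (S i) * W (S (S i))) 0);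
      try reflexivity; exfalso.
    + assert (0 < (W i * W (S i)) * (W (S i) * W (S (S i)))) by nra.
      assert (0 < W (S i) * W (S i)) by nra. nra.
    + assert (0 <= (W i * W (S i)) * (W (S i) * W (S (S i)))) by nra.
      assert (0 < W (S i) * W (S i)) by nra. nra.
Qed.

(** The induction runs over decided nodes only and is strong because an undecided node is passed
    together with both of its edges, which contribute exactly one to either count. *)
Lemma follows_count f e U V : f = 1 \/ f = -1 -> e = 1 \/ e = -1 ->
  f = 1 \/ e = f -> follows n Z f U -> follows n Z e V ->
  forall k, (S k <= n)%nat -> (exists r, decided Z (S k) r) ->
  (count_upto k (fun j => sc_indicator U (S j)) <=
   count_upto k (fun j => sc_indicator V (S j)))%nat.
Proof.
  intros Hf He Hfe FU FV k.
  assert (f2 : f * f = 1) by (destruct Hf as [->| ->]; ring).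
  assert (e2 : e * e = 1) by (destruct He as [->| ->]; ring).
  assert (NZ : forall a W i r, follows n Z a W -> decided Z i r -> (1 <= i <= n)%nat -> W i <> 0).
  { intros a W i r F D Hi E; pose proof (follows_decided _ _ _ _ _ _ F D Hi) as P.
    rewrite E in P; lra. }
  induction k as [k IH] using (well_founded_induction lt_wf); intros Hk (r & D).
  destruct k as [|k]; [simpl; lia |].
  destruct (decided_or_undecided n Z (S k) Znz ltac:(lia)) as (q & [Q|Q]).
  - specialize (IH k ltac:(lia) ltac:(lia) (ex_intro _ q Q)); simpl.
    enough (sc_indicator U (S k) <= sc_indicator V (S k))%nat by lia.
    pose proof (follows_edge f e U V (S k) q r Hf He Hfe FU FV ltac:(lia) Hk Q D) as E.
    pose proof (NZ _ _ _ _ FU Q ltac:(lia)) as NU.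
    unfold sc_indicator.
    destruct (Req_EM_T (U (S k)) 0); [contradiction |].
    destruct (Req_EM_T (V (S k)) 0); [destruct (Rlt_dec (U (S k) * U (S (S k))) 0); lia |].
    destruct (Rlt_dec (U (S k) * U (S (S k))) 0); [| lia].
    destruct (Rlt_dec (V (S k) * V (S (S k))) 0); [lia | exfalso; auto].
  - destruct (undecided_neighbours (S k) q ltac:(lia) Q) as (q' & _ & H2 & _ & D1 & D2 & _).
    destruct k as [|k]; [lia |].
    replace (S (S k) - 1)%nat with (S k) in D1 by lia.
    specialize (IH k ltac:(lia) ltac:(lia) (ex_intro _ q' D1)); simpl.
    pose proof (undecided_sign_change f U (S (S k)) q f2 FU ltac:(lia) Q) as SU.
    pose proof (undecided_sign_change e V (S (S k)) q e2 FV ltac:(lia) Q) as SV.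
    replace (S (S k) - 1)%nat with (S k) in SU, SV by lia.
    pose proof (sc_indicator_pair U (S k) (NZ _ _ _ _ FU D2 ltac:(lia))
                  (NZ _ _ _ _ FU D1 ltac:(lia)) SU).
    pose proof (sc_indicator_pair V (S k) (NZ _ _ _ _ FV D2 ltac:(lia))
                  (NZ _ _ _ _ FV D1 ltac:(lia)) SV).
    lia.
Qed.

Lemma last_node_decided : (1 <= n)%nat -> exists r, decided Z n r.
Proof.
  intros Hn.
  destruct (decided_or_undecided n Z n Znz ltac:(lia)) as (q & [Q|Q]); [eauto |].
  destruct (undecided_neighbours n q ltac:(lia) Q) as (q' & _ & _ & H & _); lia.
Qed.

End Signs.

Lemma count_upto_ext k f g : (forall i, (i < k)%nat -> f i = g i) ->
  count_upto k f = count_upto k g.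
Proof.
  induction k; intros H; simpl; [reflexivity |].
  rewrite IHk, H by (intros; try apply H; lia); reflexivity.
Qed.

Lemma sigma_pad n x :
  sigma n x = count_upto (n - 1) (fun j => sc_indicator (pad n x) (S j)).
Proof.
  unfold sigma; apply count_upto_ext; intros i Hi; unfold sc_indicator.
  rewrite !pad_S by lia; reflexivity.
Qed.

Definition nonzero (n : nat) (z : nat -> R) : Prop := exists i, (i < n)%nat /\ z i <> 0.

Lemma nonzero_pad n z : nonzero n z -> exists j, (1 <= j <= n)%nat /\ pad n z j <> 0.
Proof.
  intros (i & Hi & E); exists (S i); split; [lia |].
  rewrite pad_S by assumption; exact E.
Qed.

Lemma follows_in_Lambda n z e u : (2 <= n)%nat -> nonzero n z -> e = 1 \/ e = -1 ->
  follows n (pad n z) e (pad n u) -> in_Lambda n u.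
Proof.
  intros Hn Hz He F; apply in_Lambda_pad; [exact Hn |].
  apply (follows_Lambda n (pad n z) eq_refl (pad_gt n z) (nonzero_pad n z Hz) e); [| exact F].
  destruct He as [->| ->]; ring.
Qed.

Lemma follows_sigma n z f e u v : (2 <= n)%nat -> nonzero n z ->
  f = 1 \/ f = -1 -> e = 1 \/ e = -1 -> f = 1 \/ e = f ->
  follows n (pad n z) f (pad n u) -> follows n (pad n z) e (pad n v) ->
  (sigma n u <= sigma n v)%nat.
Proof.
  intros Hn Hz Hf He Hfe FU FV; rewrite !sigma_pad.
  apply (follows_count n (pad n z) eq_refl (pad_gt n z) (nonzero_pad n z Hz) f e); try assumption.
  - lia.
  - replace (S (n - 1)) with n by lia.
    apply (last_node_decided n (pad n z) eq_refl (pad_gt n z) (nonzero_pad n z Hz)); lia.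
Qed.

(** In Lambda a vanishing node has neighbours of opposite signs and so is undecided. Only the
    conditions with [k = 0] remain, and they are the same for every [e]; thus perturbations at a
    fixed time fit the same relation as evolution in time. *)
Lemma Lambda_follows n z e u : (2 <= n)%nat -> in_Lambda n z ->
  (forall i, (i < n)%nat -> z i <> 0 -> 0 < z i * u i) -> follows n (pad n z) e (pad n u).
Proof.
  intros Hn HL Hu i k Hi Hr Hp Hs.
  rewrite in_Lambda_pad in HL by exact Hn.
  destruct k as [|k].
  - rewrite Nat.sub_0_r, Nat.add_0_r in *.
    destruct i as [|i]; [lia |].
    rewrite (pad_S n u) by lia.
    rewrite pad_S in * by lia.
    specialize (Hu i ltac:(lia) ltac:(lra)); simpl; nra.
  - specialize (HL i Hi (Hr i ltac:(lia) ltac:(lia))).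
    destruct k as [|k].
    + rewrite Nat.add_1_r in Hp; lra.
    + rewrite (Hr (S i)) in HL by lia; lra.
Qed.

Lemma in_Lambda_nonzero n z : (2 <= n)%nat -> in_Lambda n z -> nonzero n z.
Proof. intros Hn (H & _); exists 0%nat; split; [lia | exact H]. Qed.

(** Local constancy of [sigma] on Lambda: [u] and [z] both follow [z] with [e = 1], so monotonicity
    applies in both orders. *)
Lemma Lambda_same_signs n z u : (2 <= n)%nat -> in_Lambda n z ->
  (forall i, (i < n)%nat -> z i <> 0 -> 0 < z i * u i) -> in_Lambda n u /\ sigma n u = sigma n z.
Proof.
  intros Hn HL Hu.
  pose proof (in_Lambda_nonzero n z Hn HL) as Hz.
  pose proof (Lambda_follows n z 1 u Hn HL Hu) as FU.
  assert (FZ : follows n (pad n z) 1 (pad n z)).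
  { apply Lambda_follows; [exact Hn | exact HL |]; intros; nra. }
  split; [apply (follows_in_Lambda n z 1); auto |].
  apply Nat.le_antisymm; apply (follows_sigma n z 1 1); auto.
Qed.

(** * Expansion of solutions at a zero *)

Lemma sumn_ext n f g : (forall i, (i < n)%nat -> f i = g i) -> sumn n f = sumn n g.
Proof.
  induction n; intros H; simpl; [reflexivity |].
  rewrite IHn, H by (intros; try apply H; lia); reflexivity.
Qed.

Lemma sumn_truncate n k f : (k <= n)%nat ->
  (forall j, (k <= j)%nat -> (j < n)%nat -> f j = 0) -> sumn n f = sumn k f.
Proof.
  induction n; intros Hk H.
  - replace k with 0%nat by lia; reflexivity.
  - destruct (Nat.eq_dec k (S n)) as [->|]; [reflexivity |].
    simpl; rewrite IHn, (H n) by (intros; try apply H; lia); ring.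
Qed.

(** The coefficient [1] at either boundary multiplies a padding zero; it keeps the two outer
    coefficients positive at every node. *)
Lemma sumn_tridiag n M x i : tridiag_pos n M -> (i < n)%nat ->
  sumn n (fun j => M i j * x j) =
  (if Nat.eqb i 0 then 1 else M i (i - 1)%nat) * pad n x i + M i i * pad n x (S i) +
  (if Nat.ltb (S i) n then M i (S i) else 1) * pad n x (S (S i)).
Proof.
  intros (HM & _) Hi.
  assert (E : sumn (S i) (fun j => M i j * x j) =
    (if Nat.eqb i 0 then 1 else M i (i - 1)%nat) * pad n x i + M i i * pad n x (S i)).
  { rewrite pad_S by lia; destruct i as [|i]; simpl sumn; [simpl; ring |].
    rewrite (sumn_truncate i 0) by (intros; try rewrite HM by lia; try ring; lia).
    replace (S i - 1)%nat with i by lia.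
    rewrite pad_S by lia; simpl; ring. }
  rewrite <- E.
  destruct (Nat.ltb_spec (S i) n) as [H|H].
  - rewrite pad_S by lia.
    rewrite (sumn_truncate n (S (S i))) by (intros; try rewrite HM by lia; try ring; lia).
    reflexivity.
  - rewrite pad_gt by lia; replace n with (S i) by lia; ring.
Qed.

(** The expansion [f h = c * h ^ k + o (h ^ k)]; the inequality is not strict, so that [h = 0] is
    allowed. *)
Definition little_o (f : R -> R) (c : R) (k : nat) : Prop :=
  forall eps, 0 < eps -> exists delta, 0 < delta /\
    forall h, Rabs h < delta -> Rabs (f h - c * h ^ k) <= eps * Rabs h ^ k.

Lemma little_o_ext f g c c' k : (forall h, f h = g h) -> c = c' ->
  little_o f c k -> little_o g c' k.
Proof.
  intros Hf <- H eps He; destruct (H eps He) as (d & Hd & K); exists d; split; [exact Hd |].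
  intros h Hh; rewrite <- Hf; auto.
Qed.

Lemma little_o_zero k : little_o (fun _ => 0) 0 k.
Proof.
  intros eps He; exists 1; split; [lra |]; intros h _.
  replace (0 - 0 * h ^ k) with 0 by ring; rewrite Rabs_R0.
  apply Rmult_le_pos; [lra | apply pow_le, Rabs_pos].
Qed.

Lemma little_o_plus f g c c' k : little_o f c k -> little_o g c' k ->
  little_o (fun h => f h + g h) (c + c') k.
Proof.
  intros Hf Hg eps He.
  destruct (Hf (eps / 2) ltac:(lra)) as (d1 & Hd1 & K1).
  destruct (Hg (eps / 2) ltac:(lra)) as (d2 & Hd2 & K2).
  exists (Rmin d1 d2); split; [apply Rmin_pos; assumption |].
  intros h Hh.
  specialize (K1 h (Rlt_le_trans _ _ _ Hh (Rmin_l _ _))).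
  specialize (K2 h (Rlt_le_trans _ _ _ Hh (Rmin_r _ _))).
  replace (f h + g h - (c + c') * h ^ k) with ((f h - c * h ^ k) + (g h - c' * h ^ k)) by ring.
  eapply Rle_trans; [apply Rabs_triang | lra].
Qed.

Definition continuous_at (f : R -> R) (t : R) : Prop :=
  forall eps, 0 < eps -> exists delta, 0 < delta /\
    forall s, Rabs (s - t) < delta -> Rabs (f s - f t) < eps.

Lemma little_o_mult (a f : R -> R) (t c : R) (k : nat) : continuous_at a t -> little_o f c k ->
  little_o (fun h => a (t + h) * f h) (a t * c) k.
Proof.
  intros Ha Hf eps He.
  set (e1 := Rmin 1 (eps / (2 * (Rabs c + 1)))).
  pose proof (Rabs_pos c) as Pc; pose proof (Rabs_pos (a t)) as Pa.
  assert (He1 : 0 < e1).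
  { apply Rmin_pos; [lra | apply Rdiv_lt_0_compat; lra]. }
  set (e2 := eps / (2 * (Rabs (a t) + 1))).
  assert (He2 : 0 < e2) by (apply Rdiv_lt_0_compat; lra).
  destruct (Ha e1 He1) as (d1 & Hd1 & K1).
  destruct (Hf e2 He2) as (d2 & Hd2 & K2).
  exists (Rmin d1 d2); split; [apply Rmin_pos; assumption |].
  intros h Hh.
  specialize (K1 (t + h)).
  replace (t + h - t) with h in K1 by ring.
  specialize (K1 (Rlt_le_trans _ _ _ Hh (Rmin_l _ _))).
  specialize (K2 h (Rlt_le_trans _ _ _ Hh (Rmin_r _ _))).
  replace (a (t + h) * f h - a t * c * h ^ k)
    with (a (t + h) * (f h - c * h ^ k) + (a (t + h) - a t) * (c * h ^ k)) by ring.
  eapply Rle_trans; [apply Rabs_triang |].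
  rewrite !Rabs_mult, <- RPow_abs.
  assert (Ph : 0 <= Rabs h ^ k) by apply pow_le, Rabs_pos.
  assert (Q1 : Rabs (a (t + h)) <= Rabs (a t) + 1).
  { replace (a (t + h)) with (a t + (a (t + h) - a t)) by ring.
    eapply Rle_trans; [apply Rabs_triang |].
    assert (e1 <= 1) by apply Rmin_l; lra. }
  assert (Q2 : Rabs (a (t + h) - a t) * Rabs c <= eps / 2).
  { assert (E : e1 <= eps / (2 * (Rabs c + 1))) by apply Rmin_r.
    apply Rle_trans with (eps / (2 * (Rabs c + 1)) * (Rabs c + 1)).
    - apply Rmult_le_compat; try apply Rabs_pos; lra.
    - right; field; lra. }
  assert (Q3 : Rabs (a (t + h)) * Rabs (f h - c * h ^ k) <= eps / 2 * Rabs h ^ k).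
  { apply Rle_trans with ((Rabs (a t) + 1) * (e2 * Rabs h ^ k)).
    - apply Rmult_le_compat; try apply Rabs_pos; assumption.
    - right; unfold e2; field; lra. }
  nra.
Qed.

Lemma MVT_abs (f f' : R -> R) (b M : R) :
  (forall c, Rabs c <= Rabs b -> derivable_pt_lim f c (f' c) /\ Rabs (f' c) <= M) ->
  Rabs (f b - f 0) <= M * Rabs b.
Proof.
  intros H.
  destruct (Rtotal_order b 0) as [Hb|[->|Hb]].
  - destruct (MVT_cor2 f f' b 0 Hb) as (c & E & Hc).
    { intros c Hc; apply H; rewrite !Rabs_left1 by lra; lra. }
    rewrite Rabs_minus_sym, E, Rabs_mult.
    replace (Rabs (0 - b)) with (Rabs b) by (rewrite Rabs_minus_sym; f_equal; ring).
    apply Rmult_le_compat_r; [apply Rabs_pos |].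
    apply H; rewrite !Rabs_left1 by lra; lra.
  - rewrite Rminus_diag, Rabs_R0; lra.
  - destruct (MVT_cor2 f f' 0 b Hb) as (c & E & Hc).
    { intros c Hc; apply H; rewrite !Rabs_right by lra; lra. }
    rewrite E, Rabs_mult, Rminus_0_r.
    apply Rmult_le_compat_r; [apply Rabs_pos |].
    apply H; rewrite !Rabs_right by lra; lra.
Qed.

(** The mean value theorem, applied to the remainder [f s - c / INR (S k) * s ^ S k], stands in for
    integrating the expansion of [g]. *)
Lemma little_o_primitive (f g : R -> R) (c : R) (k : nat) : f 0 = 0 ->
  (forall h, derivable_pt_lim f h (g h)) -> little_o g c k ->
  little_o f (c / INR (S k)) (S k).
Proof.
  intros f0 Hf Hg eps He.
  destruct (Hg eps He) as (d & Hd & K).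
  exists d; split; [exact Hd |]; intros h Hh.
  assert (Hk : INR (S k) <> 0) by (apply not_0_INR; lia).
  pose proof (MVT_abs (fun s => f s - c / INR (S k) * s ^ S k)
    (fun s => g s - c * s ^ k) h (eps * Rabs h ^ k)) as M.
  cbv beta in M.
  replace (f 0 - c / INR (S k) * 0 ^ S k) with 0 in M by (rewrite f0; simpl; ring).
  rewrite Rminus_0_r in M.
  replace (eps * Rabs h ^ S k) with (eps * Rabs h ^ k * Rabs h) by (simpl; ring).
  apply M; intros s Hs; split.
  - replace (c * s ^ k) with (c / INR (S k) * (INR (S k) * s ^ Nat.pred (S k)))
      by (rewrite Nat.pred_succ; field; exact Hk).
    apply (derivable_pt_lim_minus f (fun s => c / INR (S k) * s ^ S k)); [apply Hf |].
    apply (derivable_pt_lim_scal (fun s => s ^ S k)), derivable_pt_lim_pow.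
  - eapply Rle_trans; [apply K; lra |].
    apply Rmult_le_compat_l; [lra |].
    apply pow_incr; split; [apply Rabs_pos | exact Hs].
Qed.

Lemma finite_common_radius (n : nat) (P : nat -> R -> Prop) :
  (forall i, (i < n)%nat -> exists delta, 0 < delta /\ forall h, Rabs h < delta -> P i h) ->
  exists delta, 0 < delta /\ forall i h, (i < n)%nat -> Rabs h < delta -> P i h.
Proof.
  induction n; intros H.
  - exists 1; split; [lra | intros; lia].
  - destruct IHn as (d1 & Hd1 & K1); [intros; apply H; lia |].
    destruct (H n ltac:(lia)) as (d2 & Hd2 & K2).
    exists (Rmin d1 d2); split; [apply Rmin_pos; assumption |].
    intros i h Hi Hh.
    pose proof (Rmin_l d1 d2); pose proof (Rmin_r d1 d2).
    destruct (Nat.eq_dec i n) as [->|]; [apply K2; lra | apply K1; [lia | lra]].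
Qed.

Definition is_solution (n : nat) (A : R -> nat -> nat -> R) (x : R -> nat -> R) : Prop :=
  forall i t, (i < n)%nat ->
    derivable_pt_lim (fun s => x s i) t (sumn n (fun j => A t i j * x t j)).

Lemma derivable_pt_lim_shift f t h l : derivable_pt_lim f (t + h) l ->
  derivable_pt_lim (fun s => f (t + s)) h l.
Proof.
  intros H eps He; destruct (H eps He) as (d & K); exists d; intros s Hs Hd.
  replace (t + (h + s)) with (t + h + s) by ring; auto.
Qed.

Lemma derivable_pt_lim_continuous_at f t l : derivable_pt_lim f t l -> continuous_at f t.
Proof.
  intros H.
  assert (C : continuity_pt f t) by (apply derivable_continuous_pt; exists l; exact H).
  intros eps He; destruct (C eps He) as (d & Hd & K); exists d; split; [exact Hd |].
  intros s Hs; destruct (Req_EM_T t s) as [<-|Hn].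
  - rewrite Rminus_diag, Rabs_R0; exact He.
  - apply K; split; [split; [exact I | exact Hn] | exact Hs].
Qed.

(** A supremum argument on [[a, b]]. As [P] may fail at the supremum [c], the local comparison
    starts from a point [q] of [P] at or just below [c]. It serves once for time with [P] being
    membership in Lambda, and once with trivial [P] as the connectedness of an interval. *)
Lemma local_to_global_decreasing (P : R -> Prop) (g : R -> nat) :
  (forall t, exists delta, 0 < delta /\
    (forall s, 0 < Rabs (s - t) < delta -> P s) /\
    (forall a b, t - delta < a -> a < b -> b < t + delta -> P a -> P b -> (g b <= g a)%nat)) ->
  forall a b, a < b -> P a -> P b -> (g b <= g a)%nat.
Proof.
  intros H a b Hab Pa Pb.
  set (E := fun r => a <= r <= b /\ forall s, a <= s <= r -> P s -> (g s <= g a)%nat).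
  assert (Ea : E a).
  { split; [lra |]; intros s Hs _; replace s with a by lra; lia. }
  destruct (completeness E) as (c & Hub & Hlub).
  { exists b; intros r (Hr & _); lra. }
  { exists a; exact Ea. }
  assert (Hac : a <= c) by (apply Hub, Ea).
  assert (Hcb : c <= b) by (apply Hlub; intros r (Hr & _); lra).
  destruct (H c) as (d & Hd & HP & Hg).
  assert (Q : exists q, c - d < q /\ q <= c /\ a <= q /\ P q /\ (g q <= g a)%nat /\
    forall s, a <= s <= q -> P s -> (g s <= g a)%nat).
  { destruct (Req_EM_T a c) as [<-|Hne].
    { exists a; repeat split; try lra; auto; try lia.
      intros s Hs _; replace s with a by lra; lia. }
    set (q0 := Rmax a (c - d)).
    assert (Hq0 : q0 < c) by (unfold q0; apply Rmax_lub_lt; lra).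
    assert (Ha0 : a <= q0 /\ c - d <= q0) by (split; [apply Rmax_l | apply Rmax_r]).
    destruct (classic (exists r, E r /\ q0 < r)) as [(r & (Hr1 & Hr2) & Hr)|C].
    2: { exfalso; assert (c <= q0); [apply Hlub; intros r Hr | lra].
         apply Rnot_lt_le; intros Hl; apply C; exists r; auto. }
    assert (Hrc : r <= c) by (apply Hub; split; assumption).
    set (q := (q0 + r) / 2).
    assert (Hq : q0 < q < r) by (unfold q; lra).
    assert (Pq : P q).
    { apply HP; rewrite Rabs_left by lra; lra. }
    exists q; repeat split; try lra; auto.
    - apply Hr2; [lra | exact Pq].
    - intros s Hs; apply Hr2; lra. }
  destruct Q as (q & Hq1 & Hq2 & Hq3 & Pq & Hgq & Hs).
  assert (Ext : forall s, a <= s -> s < c + d -> P s -> (g s <= g a)%nat).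
  { intros s H1 H2 Ps; destruct (Rle_lt_dec s q); [apply Hs; auto; lra |].
    specialize (Hg q s Hq1 r H2 Pq Ps); lia. }
  destruct (Rlt_le_dec b (c + d)); [apply Ext; auto; lra |].
  exfalso; assert (c + d / 2 <= c); [| lra].
  apply Hub; split; [lra |]; intros s Hs' Ps; apply Ext; auto; lra.
Qed.

Section Expansion.

Variables (n : nat) (A : R -> nat -> nat -> R) (x : R -> nat -> R).
Hypothesis Hn : (2 <= n)%nat.
Hypothesis A_tridiag : forall t, tridiag_pos n (A t).
Hypothesis A_cont : forall i j t, (i < n)%nat -> (j < n)%nat ->
  continuous_at (fun s => A s i j) t.
Hypothesis x_sol : is_solution n A x.

(** By induction on the order: the derivative at node [i] is a positive combination of the two
    neighbours, whose zero radius is smaller by one, plus a multiple of node [i] itself, which is of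
    higher order. Integrating raises the order by one. *)
Lemma solution_expansion t k : forall i, (1 <= i <= n)%nat -> zero_radius (pad n (x t)) i k ->
  exists a b, 0 < a /\ 0 < b /\
    little_o (fun h => pad n (x (t + h)) i)
      (a * pad n (x t) (i - k)%nat + b * pad n (x t) (i + k)%nat) k.
Proof.
  set (Z := pad n (x t)).
  induction k as [|k IH]; intros i Hi Hr.
  (* At order zero both end values are [Z i], so the weights have to add up to one. *)
  - exists (1/2), (1/2); split; [lra |]; split; [lra |].
    destruct i as [|i]; [lia |].
    intros eps He.
    destruct (derivable_pt_lim_continuous_at _ _ _ (x_sol i t ltac:(lia)) eps He) as (d & Hd & K).
    exists d; split; [exact Hd |]; intros h Hh.
    specialize (K (t + h)); replace (t + h - t) with h in K by ring.
    specialize (K Hh); cbv beta in K.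
    rewrite Nat.sub_0_r, Nat.add_0_r; unfold Z; rewrite !pad_S by lia; simpl.
    replace (x (t + h) i - (1 / 2 * x t i + 1 / 2 * x t i) * 1) with (x (t + h) i - x t i) by field.
    lra.
  - assert (Left : exists a, 0 < a /\
      little_o (fun h => pad n (x (t + h)) (i - 1)) (a * Z (i - S k)%nat) k).
    { destruct (Nat.eq_dec i 1) as [->|Hi1].
      - exists 1; split; [lra |].
        replace (1 - S k)%nat with 0%nat by lia; unfold Z; simpl.
        apply (little_o_ext (fun _ => 0) _ 0); [reflexivity | ring | apply little_o_zero].
      - destruct (IH (i - 1)%nat ltac:(lia)) as (a & b & Ha & Hb & K).
        { intros j Hj1 Hj2; apply Hr; lia. }
        replace (i - 1 - k)%nat with (i - S k)%nat in K by lia.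
        (* For [k = 0] the two end values of the neighbour coincide and their weights add; otherwise
           the inner one vanishes. *)
        destruct k as [|k].
        + exists (a + b); split; [lra |].
          apply (little_o_ext _ _ _ _ _ (fun _ => eq_refl)) with (2 := K).
          replace (i - 1 + 0)%nat with (i - 1)%nat by lia; ring.
        + exists a; split; [lra |].
          apply (little_o_ext _ _ _ _ _ (fun _ => eq_refl)) with (2 := K).
          rewrite (Hr (i - 1 + S k)%nat) by lia; ring. }
    assert (Right : exists b, 0 < b /\
      little_o (fun h => pad n (x (t + h)) (S i)) (b * Z (i + S k)%nat) k).
    { destruct (Nat.eq_dec i n) as [->|Hi1].
      - exists 1; split; [lra |].
        apply (little_o_ext (fun _ => 0) _ 0); [| | apply little_o_zero].
        + intros h; rewrite pad_gt by lia; reflexivity.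
        + unfold Z; rewrite pad_gt by lia; ring.
      - destruct (IH (S i)%nat ltac:(lia)) as (a & b & Ha & Hb & K).
        { intros j Hj1 Hj2; apply Hr; lia. }
        replace (S i + k)%nat with (i + S k)%nat in K by lia.
        destruct k as [|k].
        + exists (a + b); split; [lra |].
          apply (little_o_ext _ _ _ _ _ (fun _ => eq_refl)) with (2 := K).
          replace (S i - 0)%nat with (i + 1)%nat by lia; ring.
        + exists b; split; [lra |].
          apply (little_o_ext _ _ _ _ _ (fun _ => eq_refl)) with (2 := K).
          rewrite (Hr (S i - S k)%nat) by lia; ring. }
    (* Radius [S k] makes the end values at distance [k] vanish, by hypothesis or by padding, so the
       diagonal term drops out at order [k]. *)
    assert (Mid : little_o (fun h => pad n (x (t + h)) i) 0 k).
    { destruct (IH i Hi) as (a & b & Ha & Hb & K).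
      { intros j Hj1 Hj2; apply Hr; lia. }
      apply (little_o_ext _ _ _ _ _ (fun _ => eq_refl)) with (2 := K).
      destruct (le_lt_dec k i).
      - rewrite (Hr (i - k)%nat), (Hr (i + k)%nat) by lia; ring.
      - rewrite (Hr (i + k)%nat) by lia.
        replace (i - k)%nat with 0%nat by lia; unfold Z; simpl; ring. }
    destruct Left as (a & Ha & Left), Right as (b & Hb & Right).
    destruct i as [|i]; [lia |].
    replace (S i - 1)%nat with i in Left by lia.
    set (l := fun s => if Nat.eqb i 0 then 1 else A s i (i - 1)%nat).
    set (r := fun s => if Nat.ltb (S i) n then A s i (S i) else 1).
    assert (Cst : forall s, continuous_at (fun _ => 1) s).
    { intros s eps He; exists 1; split; [lra |]; intros.
      rewrite Rminus_diag, Rabs_R0; exact He. }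
    assert (Cl : continuous_at l t).
    { unfold l; destruct (Nat.eqb_spec i 0); [apply Cst | apply A_cont; lia]. }
    assert (Cr : continuous_at r t).
    { unfold r; destruct (Nat.ltb_spec (S i) n); [apply A_cont; lia | apply Cst]. }
    assert (Pl : 0 < l t).
    { unfold l; destruct (Nat.eqb_spec i 0); [lra |].
      destruct (A_tridiag t) as (_ & P); specialize (P (i - 1)%nat ltac:(lia)).
      replace (S (i - 1)) with i in P by lia; apply P. }
    assert (Pr : 0 < r t).
    { unfold r; destruct (Nat.ltb_spec (S i) n); [| lra].
      destruct (A_tridiag t) as (_ & P); apply P; assumption. }
    assert (Pk : 0 < / INR (S k)) by (apply Rinv_0_lt_compat, lt_0_INR; lia).
    exists (l t * a * / INR (S k)), (r t * b * / INR (S k)).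
    split; [repeat apply Rmult_lt_0_compat; assumption |].
    split; [repeat apply Rmult_lt_0_compat; assumption |].
    pose proof (little_o_plus _ _ _ _ _
      (little_o_plus _ _ _ _ _ (little_o_mult l _ t _ k Cl Left)
        (little_o_mult (fun s => A s i i) _ t _ k (A_cont i i t ltac:(lia) ltac:(lia)) Mid))
      (little_o_mult r _ t _ k Cr Right)) as Sum.
    cbv beta in Sum.
    apply (little_o_ext (fun h => x (t + h) i) _
      ((l t * (a * Z (S i - S k)%nat) + A t i i * 0 + r t * (b * Z (S i + S k)%nat)) / INR (S k))).
    + intros h; rewrite pad_S by lia; reflexivity.
    + unfold Rdiv; ring.
    + apply little_o_primitive with (3 := Sum).
      * rewrite Rplus_0_r, <- (pad_S n (x t) i) by lia; apply Hr; lia.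
      * intros h; apply derivable_pt_lim_shift with (f := fun s => x s i).
        pose proof (x_sol i (t + h) ltac:(lia)) as D.
        rewrite (sumn_tridiag n (A (t + h))) in D by (auto; lia); exact D.
Qed.

Lemma solution_follows t : nonzero n (x t) ->
  exists delta, 0 < delta /\ forall h, Rabs h < delta ->
    (0 < h -> follows n (pad n (x t)) 1 (pad n (x (t + h)))) /\
    (h < 0 -> follows n (pad n (x t)) (-1) (pad n (x (t + h)))).
Proof.
  intros Hnz.
  set (Z := pad n (x t)).
  set (P := fun i k h => (1 <= i)%nat -> zero_radius Z i k ->
    0 <= Z (i - k)%nat * Z (i + k)%nat -> Z (i - k)%nat + Z (i + k)%nat <> 0 ->
    h <> 0 -> 0 < (Z (i - k)%nat + Z (i + k)%nat) * h ^ k * pad n (x (t + h)) i).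
  destruct (finite_common_radius (S n) (fun i h => forall k, (k < S n)%nat -> P i k h))
    as (d & Hd & K).
  { intros i Hi.
    destruct (finite_common_radius (S n) (P i)) as (d & Hd & K).
    2: { exists d; split; [exact Hd |]; intros; apply K; assumption. }
    intros k Hk; unfold P.
    destruct (classic ((1 <= i)%nat /\ zero_radius Z i k /\
      0 <= Z (i - k)%nat * Z (i + k)%nat /\ Z (i - k)%nat + Z (i + k)%nat <> 0)) as [C|C].
    2: { exists 1; split; [lra |]; intros; exfalso; apply C; auto. }
    destruct C as (H1 & H2 & H3 & H4).
    destruct (solution_expansion t k i ltac:(lia) H2) as (a & b & Ha & Hb & E).
    fold Z in E.
    set (z1 := Z (i - k)%nat) in *; set (z2 := Z (i + k)%nat) in *.
    assert (Sg : 0 < (z1 + z2) * (a * z1 + b * z2)).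
    { assert (0 < z1 * z1 \/ 0 < z2 * z2).
      { destruct (Req_EM_T z1 0); [right | left]; nra. }
      assert (0 <= z1 * z1) by nra. assert (0 <= z2 * z2) by nra.
      replace ((z1 + z2) * (a * z1 + b * z2))
        with (a * (z1 * z1) + b * (z2 * z2) + (a + b) * (z1 * z2)) by ring.
      assert (0 <= (a + b) * (z1 * z2)) by (apply Rmult_le_pos; lra).
      assert (0 <= a * (z1 * z1)) by (apply Rmult_le_pos; lra).
      assert (0 <= b * (z2 * z2)) by (apply Rmult_le_pos; lra).
      destruct H; [assert (0 < a * (z1 * z1)) | assert (0 < b * (z2 * z2))];
        try (apply Rmult_lt_0_compat; lra); lra. }
    set (c := a * z1 + b * z2) in *.
    assert (Hc : c <> 0) by nra.
    (* With half the leading coefficient as tolerance, the remainder cannot reverse the sign. *)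
    destruct (E (Rabs c / 2)) as (d & Hd & K).
    { pose proof (Rabs_pos_lt c Hc); lra. }
    exists d; split; [exact Hd |]; intros h Hh _ _ _ _ Hh0.
    specialize (K h Hh).
    rewrite RPow_abs in K.
    assert (Hp : h ^ k <> 0) by (apply pow_nonzero; assumption).
    set (p := h ^ k) in *; set (u := pad n (x (t + h)) i) in *.
    assert (Q : 0 < c * p * u).
    { assert (Hcp : 0 < Rabs (c * p)) by (apply Rabs_pos_lt; nra).
      replace (Rabs c / 2 * Rabs p) with (Rabs (c * p) / 2) in K by (rewrite Rabs_mult; field).
      set (q := c * p) in *.
      destruct (Rcase_abs q); [rewrite (Rabs_left q) in * by lra | rewrite (Rabs_right q) in * by lra];
        unfold Rabs in K; destruct (Rcase_abs (u - q)); nra. }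
    assert (0 < ((z1 + z2) * c) * (c * p * u)) by (apply Rmult_lt_0_compat; assumption).
    assert (0 < c * c) by nra.
    replace ((z1 + z2) * c * (c * p * u)) with ((c * c) * ((z1 + z2) * p * u)) in H by ring.
    nra. }
  exists d; split; [exact Hd |]; intros h Hh.
  (* For [k > n] both end values are padding zeros, so finitely many orders, and one common radius,
     suffice. *)
  assert (Kk : forall i k, (1 <= i <= n)%nat -> zero_radius Z i k ->
    Z (i - k)%nat + Z (i + k)%nat <> 0 -> (k < S n)%nat).
  { intros i k Hi Hr Hs; apply NNPP; intros C; apply Hs.
    unfold Z at 2; rewrite pad_gt by lia.
    replace (i - k)%nat with 0%nat by lia; unfold Z; simpl; ring. }
  assert (G : forall e, h = e * Rabs h -> h <> 0 ->
    follows n Z e (pad n (x (t + h)))).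
  { intros e He Hh0 i k Hi Hr Hp Hs.
    pose proof (K i h ltac:(lia) Hh k (Kk i k Hi Hr Hs) ltac:(lia) Hr Hp Hs Hh0) as Q.
    rewrite He in Q at 1.
    rewrite Rpow_mult_distr in Q.
    assert (0 < Rabs h ^ k) by apply pow_lt, Rabs_pos_lt, Hh0.
    set (s := Z (i - k)%nat + Z (i + k)%nat) in *.
    replace (s * (e ^ k * Rabs h ^ k) * pad n (x (t + h)) i)
      with (Rabs h ^ k * (s * e ^ k * pad n (x (t + h)) i)) in Q by ring.
    nra. }
  split; intros Hs; apply G; try lra.
  - rewrite Rabs_right by lra; ring.
  - rewrite Rabs_left by lra; ring.
Qed.

Lemma solution_Lambda_near t : nonzero n (x t) ->
  exists delta, 0 < delta /\ forall s, 0 < Rabs (s - t) < delta -> in_Lambda n (x s).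
Proof.
  intros Hz; destruct (solution_follows t Hz) as (d & Hd & K).
  exists d; split; [exact Hd |]; intros s (Hs1 & Hs2).
  destruct (K (s - t) Hs2) as (K1 & K2).
  replace (t + (s - t)) with s in * by ring.
  destruct (Rtotal_order (s - t) 0) as [C|[C|C]].
  - apply (follows_in_Lambda n (x t) (-1)); auto.
  - rewrite C, Rabs_R0 in Hs1; lra.
  - apply (follows_in_Lambda n (x t) 1); auto.
Qed.

Lemma sigma_decreasing : (forall t, nonzero n (x t)) ->
  forall a b, a < b -> in_Lambda n (x a) -> in_Lambda n (x b) ->
  (sigma n (x b) <= sigma n (x a))%nat.
Proof.
  intros Hz; apply (local_to_global_decreasing (fun t => in_Lambda n (x t)) (fun t => sigma n (x t))).
  intros t; destruct (solution_follows t (Hz t)) as (d & Hd & K).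
  destruct (solution_Lambda_near t (Hz t)) as (d' & Hd' & K').
  exists (Rmin d d'); split; [apply Rmin_pos; assumption |].
  pose proof (Rmin_l d d'); pose proof (Rmin_r d d').
  split; [intros s Hs; apply K'; lra |].
  assert (F : forall s, t - Rmin d d' < s < t + Rmin d d' -> in_Lambda n (x s) ->
    (t <= s -> follows n (pad n (x t)) 1 (pad n (x s))) /\
    (s <= t -> follows n (pad n (x t)) (-1) (pad n (x s)))).
  { intros s Hs Ls.
    assert (Ks := K (s - t)).
    replace (t + (s - t)) with s in Ks by ring.
    destruct Ks as (Ks1 & Ks2); [apply Rabs_def1; lra |].
    (* If a compared time is [t] itself, the state there is in Lambda and follows itself in both
       directions. *)
    destruct (Req_EM_T s t) as [->|Hst].
    - split; intros _; apply Lambda_follows; auto; intros; nra.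
    - split; intros; [apply Ks1 | apply Ks2]; lra. }
  intros a b Ha Hab Hb La Lb.
  destruct (F a ltac:(lra) La) as (Fa1 & Fa2), (F b ltac:(lra) Lb) as (Fb1 & Fb2).
  destruct (Rle_lt_dec t b) as [Htb|Htb].
  - destruct (Rle_lt_dec t a).
    + apply (follows_sigma n (x t) 1 1); auto.
    + apply (follows_sigma n (x t) 1 (-1)); auto; apply Fa2; lra.
  - apply (follows_sigma n (x t) (-1) (-1)); auto; [apply Fb2 | apply Fa2]; lra.
Qed.

End Expansion.

(** * Estimates and compactness *)

Lemma sumn_plus n f g : sumn n (fun i => f i + g i) = sumn n f + sumn n g.
Proof. induction n; simpl; [ring | rewrite IHn; ring]. Qed.

Lemma sumn_scal n a f : sumn n (fun i => a * f i) = a * sumn n f.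
Proof. induction n; simpl; [ring | rewrite IHn; ring]. Qed.

Lemma sumn_const n a : sumn n (fun _ => a) = INR n * a.
Proof. induction n; simpl sumn; [simpl; ring | rewrite IHn, S_INR; ring]. Qed.

Lemma sumn_le n f g : (forall i, (i < n)%nat -> f i <= g i) -> sumn n f <= sumn n g.
Proof.
  induction n; intros H; simpl; [lra |].
  apply Rplus_le_compat; [apply IHn; intros; apply H; lia | apply H; lia].
Qed.

Lemma sumn_abs n f : Rabs (sumn n f) <= sumn n (fun i => Rabs (f i)).
Proof.
  induction n; simpl; [rewrite Rabs_R0; lra |].
  eapply Rle_trans; [apply Rabs_triang | lra].
Qed.

Lemma sumn_nonneg n f : (forall i, (i < n)%nat -> 0 <= f i) -> 0 <= sumn n f.
Proof.
  intros H; replace 0 with (sumn n (fun _ => 0)) by (rewrite sumn_const; ring).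
  apply sumn_le, H.
Qed.

Lemma sumn_term_le n f i : (forall j, (j < n)%nat -> 0 <= f j) -> (i < n)%nat -> f i <= sumn n f.
Proof.
  induction n; intros H Hi; [lia | simpl].
  pose proof (H n ltac:(lia)).
  destruct (Nat.eq_dec i n) as [->|].
  - pose proof (sumn_nonneg n f ltac:(intros; apply H; lia)); lra.
  - pose proof (IHn ltac:(intros; apply H; lia) ltac:(lia)); lra.
Qed.

Lemma derivable_pt_lim_sumn n (f : R -> nat -> R) f' t :
  (forall i, (i < n)%nat -> derivable_pt_lim (fun s => f s i) t (f' i)) ->
  derivable_pt_lim (fun s => sumn n (f s)) t (sumn n f').
Proof.
  induction n; intros H; simpl; [apply derivable_pt_lim_const |].
  apply (derivable_pt_lim_plus (fun s => sumn n (f s)) (fun s => f s n)).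
  - apply IHn; intros; apply H; lia.
  - apply H; lia.
Qed.

Lemma Un_cv_sumn n (f : nat -> nat -> R) l :
  (forall i, (i < n)%nat -> Un_cv (fun k => f k i) (l i)) ->
  Un_cv (fun k => sumn n (f k)) (sumn n l).
Proof.
  induction n; intros H; simpl.
  - intros eps He; exists 0%nat; intros; unfold Rdist; rewrite Rminus_diag, Rabs_R0; exact He.
  - apply (CV_plus (fun k => sumn n (f k)) (fun k => f k n)).
    + apply IHn; intros; apply H; lia.
    + apply H; lia.
Qed.

Lemma Un_cv_const a : Un_cv (fun _ => a) a.
Proof.
  intros eps He; exists 0%nat; intros; unfold Rdist; rewrite Rminus_diag, Rabs_R0; exact He.
Qed.

Lemma Un_cv_ext u v l : (forall k, u k = v k) -> Un_cv u l -> Un_cv v l.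
Proof.
  intros H C eps He; destruct (C eps He) as (N & K); exists N; intros; rewrite <- H; auto.
Qed.

Lemma Un_cv_extract u l phi : (forall k, (k <= phi k)%nat) -> Un_cv u l ->
  Un_cv (fun k => u (phi k)) l.
Proof.
  intros H C eps He; destruct (C eps He) as (N & K); exists N; intros k Hk; apply K.
  specialize (H k); unfold ge in *; lia.
Qed.

Lemma Un_cv_le_limit u l a : Un_cv u l -> (exists N, forall k, (N <= k)%nat -> u k <= a) -> l <= a.
Proof.
  intros C (N & H); apply Rnot_lt_le; intros Hl.
  destruct (C (l - a)) as (N' & K); [lra |].
  specialize (K (max N N') ltac:(unfold ge; lia)); specialize (H (max N N') ltac:(lia)).
  unfold Rdist in K; apply Rabs_def2 in K; lra.
Qed.

Definition sqnorm (n : nat) (x : nat -> R) : R := sumn n (fun i => x i ^ 2).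

Lemma sqnorm_nonneg n x : 0 <= sqnorm n x.
Proof. apply sumn_nonneg; intros; apply pow2_ge_0. Qed.

Lemma sqr_le_sqnorm n x i : (i < n)%nat -> x i ^ 2 <= sqnorm n x.
Proof. intros Hi; apply (sumn_term_le n (fun i => x i ^ 2)); [intros; apply pow2_ge_0 | exact Hi]. Qed.

Lemma sqnorm_scal n a x : sqnorm n (fun i => a * x i) = a ^ 2 * sqnorm n x.
Proof. unfold sqnorm; rewrite <- sumn_scal; apply sumn_ext; intros; ring. Qed.

Lemma nonzero_sqnorm n x : nonzero n x <-> 0 < sqnorm n x.
Proof.
  split.
  - intros (i & Hi & E); pose proof (sqr_le_sqnorm n x i Hi); nra.
  - intros H; apply NNPP; intros C.
    assert (E : sqnorm n x = 0); [| lra].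
    unfold sqnorm; rewrite (sumn_ext n _ (fun _ => 0)); [rewrite sumn_const; ring |].
    intros i Hi; destruct (Req_EM_T (x i) 0) as [->|E]; [ring |].
    exfalso; apply C; exists i; auto.
Qed.

Lemma Un_cv_sqnorm n (f : nat -> nat -> R) l :
  (forall i, (i < n)%nat -> Un_cv (fun k => f k i) (l i)) ->
  Un_cv (fun k => sqnorm n (f k)) (sqnorm n l).
Proof.
  intros H; unfold sqnorm; apply (Un_cv_sumn n (fun k i => f k i ^ 2) (fun i => l i ^ 2)).
  intros i Hi; replace (l i ^ 2) with (l i * l i) by ring.
  apply (Un_cv_ext (fun k => f k i * f k i)); [intros; ring |].
  apply CV_mult; apply H; exact Hi.
Qed.

Lemma gronwall_right (F f : R -> R) (a T : R) :
  (forall s, 0 <= s <= T -> derivable_pt_lim F s (f s) /\ f s <= a * F s) ->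
  0 <= T -> F T <= F 0 * exp (a * T).
Proof.
  intros H HT.
  destruct (Rle_lt_or_eq_dec 0 T HT) as [HT'|<-].
  2: { rewrite Rmult_0_r, exp_0; lra. }
  destruct (MVT_cor2 (fun s => F s * exp (- a * s))
    (fun s => f s * exp (- a * s) + F s * (exp (- a * s) * (- a * 1))) 0 T HT') as (c & E & Hc).
  { intros c Hc.
    apply (derivable_pt_lim_mult F (fun s => exp (- a * s))); [apply H; lra |].
    apply (derivable_pt_lim_comp (fun s => - a * s) exp).
    - apply (derivable_pt_lim_scal id), derivable_pt_lim_id.
    - apply derivable_pt_lim_exp. }
  destruct (H c ltac:(lra)) as (_ & Hf).
  assert (Pc := exp_pos (- a * c)).
  assert (L : F T * exp (- a * T) <= F 0).
  { rewrite Rmult_0_r, exp_0, Rmult_1_r in E.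
    assert ((f c * exp (- a * c) + F c * (exp (- a * c) * (- a * 1))) * (T - 0) <= 0); [| lra].
    replace ((f c * exp (- a * c) + F c * (exp (- a * c) * (- a * 1))) * (T - 0))
      with (- ((a * F c - f c) * exp (- a * c) * T)) by ring.
    assert (0 <= (a * F c - f c) * exp (- a * c) * T); [| lra].
    repeat apply Rmult_le_pos; lra. }
  apply Rmult_le_compat_r with (r := exp (a * T)) in L; [| left; apply exp_pos].
  rewrite Rmult_assoc, <- exp_plus in L.
  replace (- a * T + a * T) with 0 in L by ring.
  rewrite exp_0 in L; lra.
Qed.

Lemma gronwall (F f : R -> R) (a T : R) :
  (forall s, Rabs s <= T -> derivable_pt_lim F s (f s) /\ Rabs (f s) <= a * F s) ->
  forall t, Rabs t <= T -> F t <= F 0 * exp (a * Rabs t).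
Proof.
  intros H t Ht; destruct (Rle_lt_dec 0 t) as [Hs|Hs].
  - rewrite Rabs_right by lra; apply (gronwall_right F f); [| exact Hs].
    intros s Hs'; destruct (H s) as (H1 & H2).
    { rewrite Rabs_right in * by lra; lra. }
    split; [exact H1 |]; eapply Rle_trans; [apply Rle_abs | exact H2].
  - rewrite Rabs_left by exact Hs.
    pose proof (gronwall_right (fun s => F (- s)) (fun s => - f (- s)) a (- t)) as G.
    cbv beta in G; rewrite Ropp_involutive, Ropp_0 in G; apply G; [| lra].
    intros s Hs'; destruct (H (- s)) as (H1 & H2).
    { rewrite Rabs_Ropp, Rabs_right by lra; rewrite Rabs_left in Ht by exact Hs; lra. }
    split.
    + replace (- f (- s)) with (f (- s) * -1) by ring.
      apply (derivable_pt_lim_comp (fun s => - s) F); [| exact H1].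
      replace (-1) with (- (1)) by ring.
      apply (derivable_pt_lim_opp id), derivable_pt_lim_id.
    + eapply Rle_trans; [| exact H2]; rewrite <- Rabs_Ropp; apply Rle_abs.
Qed.

(** Energy estimate by Gronwall; adding the constant [INR n * eta ^ 2] to the squared norm absorbs
    the forcing and makes the differential inequality homogeneous. The forcing is zero for growth
    bounds, and is the change of coefficients when solutions over two base points are subtracted. *)
Lemma forced_growth n (A : R -> nat -> nat -> R) (w g : R -> nat -> R) C eta T :
  0 <= C -> 0 <= eta ->
  (forall s i, (i < n)%nat -> Rabs s <= T ->
     derivable_pt_lim (fun r => w r i) s (sumn n (fun j => A s i j * w s j) + g s i)) ->
  (forall s i j, (i < n)%nat -> (j < n)%nat -> Rabs (A s i j) <= C) ->
  (forall s i, (i < n)%nat -> Rabs s <= T -> Rabs (g s i) <= eta) ->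
  forall t, Rabs t <= T ->
  sqnorm n (w t) <=
    (sqnorm n (w 0) + INR n * eta ^ 2) * exp ((2 * INR n * C + 1) * Rabs t).
Proof.
  intros HC Heta Hw HA Hg t Ht.
  pose proof (pos_INR n) as Pn.
  set (w' := fun s i => sumn n (fun j => A s i j * w s j) + g s i).
  pose proof (gronwall (fun s => sqnorm n (w s) + INR n * eta ^ 2)
    (fun s => sumn n (fun i => 2 * w s i * w' s i)) (2 * INR n * C + 1) T) as G.
  cbv beta in G.
  assert (0 <= INR n * eta ^ 2) by (apply Rmult_le_pos; [exact Pn | apply pow2_ge_0]).
  eapply Rle_trans; [| apply G; [clear G | exact Ht]]; [lra |].
  intros s Hs; split.
  - replace (sumn n (fun i => 2 * w s i * w' s i))
      with (sumn n (fun i => 2 * w s i * w' s i) + 0) by ring.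
    apply (derivable_pt_lim_plus (fun s => sqnorm n (w s)) (fun _ => INR n * eta ^ 2));
      [| apply derivable_pt_lim_const].
    apply (derivable_pt_lim_sumn n (fun s i => w s i ^ 2)); intros i Hi.
    replace (2 * w s i * w' s i) with (INR 2 * w s i ^ Nat.pred 2 * w' s i) by (simpl; ring).
    apply (derivable_pt_lim_comp (fun s => w s i) (fun r => r ^ 2));
      [apply Hw; assumption | apply derivable_pt_lim_pow].
  - eapply Rle_trans; [apply sumn_abs |].
    assert (E : (2 * INR n * C + 1) * (sqnorm n (w s) + INR n * eta ^ 2) >=
      sumn n (fun i => (INR n * C + 1) * w s i ^ 2 + (C * sqnorm n (w s) + eta ^ 2))).
    { rewrite sumn_plus, sumn_scal, sumn_const; fold (sqnorm n (w s)).
      assert (0 <= INR n * C * (INR n * eta ^ 2)).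
      { apply Rmult_le_pos; [apply Rmult_le_pos; assumption | assumption]. }
      nra. }
    eapply Rle_trans; [| apply Rge_le, E].
    apply sumn_le; intros i Hi; unfold w'.
    rewrite Rmult_plus_distr_l, Rmult_assoc, <- sumn_scal, <- sumn_scal.
    assert (S1 : Rabs (sumn n (fun j => 2 * (w s i * (A s i j * w s j)))) <=
      INR n * C * w s i ^ 2 + C * sqnorm n (w s)).
    { eapply Rle_trans; [apply sumn_abs |].
      replace (INR n * C * w s i ^ 2 + C * sqnorm n (w s))
        with (sumn n (fun j => C * w s i ^ 2 + C * w s j ^ 2))
        by (rewrite sumn_plus, sumn_const, sumn_scal; unfold sqnorm; ring).
      apply sumn_le; intros j Hj.
      replace (2 * (w s i * (A s i j * w s j))) with (A s i j * (2 * (w s i * w s j))) by ring.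
      rewrite Rabs_mult.
      apply Rle_trans with (C * (w s i ^ 2 + w s j ^ 2)); [| lra].
      apply Rmult_le_compat; try apply Rabs_pos; [apply HA; assumption |].
      pose proof (pow2_ge_0 (w s i + w s j)); pose proof (pow2_ge_0 (w s i - w s j)).
      apply Rabs_le; split; nra. }
    assert (S2 : Rabs (2 * w s i * g s i) <= w s i ^ 2 + eta ^ 2).
    { specialize (Hg s i Hi Hs).
      assert (g s i ^ 2 <= eta ^ 2) by (rewrite <- (pow2_abs (g s i)); apply pow_incr; split; [apply Rabs_pos | exact Hg]).
      pose proof (pow2_ge_0 (w s i + g s i)); pose proof (pow2_ge_0 (w s i - g s i)).
      apply Rabs_le; split; nra. }
    eapply Rle_trans; [apply Rabs_triang |]; lra.
Qed.

(* Composing extractions [phi] with [k <= phi k] preserves limits; they need not be monotone. *)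
Lemma extraction {T : Type} (P : nat -> T -> Prop) (u : nat -> T) :
  (forall k N, exists j, (N <= j)%nat /\ P k (u j)) ->
  exists phi, (forall k, (k <= phi k)%nat) /\ forall k, P k (u (phi k)).
Proof.
  intros H.
  exists (fun k => proj1_sig (constructive_indefinite_description _ (H k k))).
  split; intros k; apply (proj2_sig (constructive_indefinite_description _ (H k k))).
Qed.

Lemma inv_INR_eventually eps : 0 < eps -> exists N, forall k, (N <= k)%nat -> / INR (S k) < eps.
Proof.
  intros He; destruct (archimed_cor1 eps He) as (N & H1 & H2); exists N; intros k Hk.
  eapply Rle_lt_trans; [| exact H1].
  apply Rinv_le_contravar; [apply lt_0_INR; lia | apply le_INR; lia].
Qed.

Lemma bounded_seq_extract (u : nat -> R) C : (forall k, Rabs (u k) <= C) ->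
  exists phi l, (forall k, (k <= phi k)%nat) /\ Un_cv (fun k => u (phi k)) l.
Proof.
  intros H.
  destruct (Bolzano_Weierstrass u (fun c => - C <= c <= C) (compact_P3 (- C) C)) as (l & Hl).
  { intros k; specialize (H k); unfold Rabs in H; destruct (Rcase_abs (u k)); lra. }
  destruct (extraction (fun k r => Rabs (r - l) < / INR (S k)) u) as (phi & H1 & H2).
  { intros k N.
    assert (Pk : 0 < / INR (S k)) by (apply Rinv_0_lt_compat, lt_0_INR; lia).
    destruct (Hl (fun r => Rabs (r - l) < / INR (S k)) N) as (p & Hp & Hp').
    - exists (mkposreal _ Pk); intros r Hr; exact Hr.
    - exists p; auto. }
  exists phi, l; split; [exact H1 |].
  intros eps He; destruct (inv_INR_eventually eps He) as (N & HN).
  exists N; intros k Hk; unfold Rdist.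
  eapply Rlt_trans; [apply H2 | apply HN, Hk].
Qed.

Lemma bounded_vec_extract p (u : nat -> nat -> R) C :
  (forall k i, (i < p)%nat -> Rabs (u k i) <= C) ->
  exists phi l, (forall k, (k <= phi k)%nat) /\
    forall i, (i < p)%nat -> Un_cv (fun k => u (phi k) i) (l i).
Proof.
  induction p; intros H.
  - exists (fun k => k), (fun _ => 0); split; [auto | intros; lia].
  - destruct IHp as (phi & l & H1 & H2); [intros; apply H; lia |].
    destruct (bounded_seq_extract (fun k => u (phi k) p) C) as (psi & a & H3 & H4).
    { intros; apply H; lia. }
    exists (fun k => phi (psi k)), (fun i => if Nat.eqb i p then a else l i); split.
    + intros k; specialize (H1 (psi k)); specialize (H3 k); lia.
    + intros i Hi; destruct (Nat.eqb_spec i p) as [->|]; [exact H4 |].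
      apply (Un_cv_extract (fun k => u (phi k) i)); [exact H3 | apply H2; lia].
Qed.

Lemma eventually_forall p (P : nat -> nat -> Prop) :
  (forall i, (i < p)%nat -> exists N, forall k, (N <= k)%nat -> P i k) ->
  exists N, forall i k, (i < p)%nat -> (N <= k)%nat -> P i k.
Proof.
  induction p; intros H.
  - exists 0%nat; intros; lia.
  - destruct IHp as (N1 & K1); [intros; apply H; lia |].
    destruct (H p ltac:(lia)) as (N2 & K2).
    exists (max N1 N2); intros i k Hi Hk.
    destruct (Nat.eq_dec i p) as [->|]; [apply K2; lia | apply K1; lia].
Qed.

Lemma seq_choice {T : Type} (P : nat -> T -> Prop) :
  (forall k, exists p, P k p) -> exists f, forall k, P k (f k).
Proof.
  intros H; exists (fun k => proj1_sig (constructive_indefinite_description _ (H k))).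
  intros k; apply (proj2_sig (constructive_indefinite_description _ (H k))).
Qed.

(** * Growth, continuous dependence and compactness of solutions over the flow *)

Section System.

Variables (Y : Type) (d : Y -> Y -> R) (fl : Y -> R -> Y) (n : nat).
Variables (B : Y -> nat -> nat -> R) (Phi : R -> Y -> nat -> nat -> R).
Hypothesis d_metric : is_metric d.
Hypothesis Y_compact : is_compact d.
Hypothesis fl_flow : is_continuous_flow d fl.
Hypothesis B_cont : forall i j, (i < n)%nat -> (j < n)%nat -> is_continuous_fun d (fun y => B y i j).
Hypothesis Phi_fundamental : principal_fundamental_matrix n fl B Phi.

Definition sol (y : Y) (x : R -> nat -> R) : Prop := is_solution n (fun t => B (fl y t)) x.

Lemma sol_lincomb y u v a b : sol y u -> sol y v -> sol y (fun t i => a * u t i + b * v t i).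
Proof.
  intros Hu Hv i t Hi.
  rewrite (sumn_ext n _ (fun j => a * (B (fl y t) i j * u t j) + b * (B (fl y t) i j * v t j)))
    by (intros; ring).
  rewrite sumn_plus, !sumn_scal.
  apply (derivable_pt_lim_plus (fun s => a * u s i) (fun s => b * v s i));
    [apply (derivable_pt_lim_scal (fun s => u s i)) | apply (derivable_pt_lim_scal (fun s => v s i))];
    [apply Hu | apply Hv]; exact Hi.
Qed.

Lemma sol_scal y u a : sol y u -> sol y (fun t i => a * u t i).
Proof.
  intros Hu i t Hi.
  rewrite (sumn_ext n _ (fun j => a * (B (fl y t) i j * u t j))) by (intros; ring).
  rewrite sumn_scal.
  apply (derivable_pt_lim_scal (fun s => u s i)), Hu, Hi.
Qed.

Lemma sol_shift y u s : sol y u -> sol (fl y s) (fun t => u (s + t)).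
Proof.
  intros Hu i t Hi; destruct fl_flow as (_ & F & _); rewrite F.
  apply (derivable_pt_lim_shift (fun r => u r i)), Hu, Hi.
Qed.

Lemma sol_Phi y x : sol y (fun t => mat_vec n (Phi t y) x).
Proof.
  intros i t Hi; unfold mat_vec.
  destruct Phi_fundamental as (_ & P).
  assert (E : sumn n (fun j => B (fl y t) i j * sumn n (fun k => Phi t y j k * x k)) =
    sumn n (fun k => sumn n (fun j => B (fl y t) i j * Phi t y j k) * x k)).
  { assert (G : forall p, sumn n (fun j => B (fl y t) i j * sumn p (fun k => Phi t y j k * x k)) =
      sumn p (fun k => sumn n (fun j => B (fl y t) i j * Phi t y j k) * x k)).
    { induction p as [|p IH]; simpl.
      - rewrite (sumn_ext n _ (fun _ => 0)) by (intros; ring); rewrite sumn_const; ring.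
      - rewrite <- IH, Rmult_comm, <- sumn_scal, <- sumn_plus.
        apply sumn_ext; intros; ring. }
    apply G. }
  rewrite E.
  apply (derivable_pt_lim_sumn n (fun s j => Phi s y i j * x j)); intros j Hj.
  rewrite Rmult_comm.
  apply (derivable_pt_lim_ext (fun s => x j * Phi s y i j)); [intros; ring |].
  apply (derivable_pt_lim_scal (fun s => Phi s y i j)), P; assumption.
Qed.

Lemma Phi_0 y x i : (i < n)%nat -> mat_vec n (Phi 0 y) x i = x i.
Proof.
  intros Hi; unfold mat_vec; destruct Phi_fundamental as (P & _).
  rewrite (sumn_ext n _ (fun j => if Nat.eqb i j then x j else 0)).
  2: { intros j Hj; rewrite P by assumption; destruct (Nat.eqb i j); ring. }
  rewrite (sumn_truncate n (S i)) by
    (lia || (intros; destruct (Nat.eqb_spec i j); [lia | reflexivity])).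
  simpl; rewrite Nat.eqb_refl.
  rewrite (sumn_truncate i 0) by
    (lia || (intros; destruct (Nat.eqb_spec i j); [lia | reflexivity])).
  simpl; ring.
Qed.

Lemma continuous_fun_bounded f : is_continuous_fun d f -> exists C, forall y, Rabs (f y) <= C.
Proof.
  intros Hf.
  destruct (Y_compact nat (fun k y => Rabs (f y) < INR k)) as (l & Hl).
  - intros k y Hy; destruct (Hf y (INR k - Rabs (f y))) as (r & Hr & K); [lra |].
    exists r; split; [exact Hr |]; intros z Hz; specialize (K z Hz).
    pose proof (Rabs_triang (f z - f y) (f y)) as Tr.
    replace (f z - f y + f y) with (f z) in Tr by ring; lra.
  - intros y; destruct (INR_unbounded (Rabs (f y))) as (k & Hk); exists k; lra.
  - exists (INR (list_max l)); intros y; destruct (Hl y) as (k & Hk & Hy).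
    left; eapply Rlt_le_trans; [exact Hy |]; apply le_INR.
    pose proof (proj1 (list_max_le l (list_max l)) (Nat.le_refl _)) as Q.
    rewrite Forall_forall in Q; auto.
Qed.

Lemma B_bounded : exists C, 0 <= C /\
  forall y i j, (i < n)%nat -> (j < n)%nat -> Rabs (B y i j) <= C.
Proof.
  assert (H1 : forall i p, (i < n)%nat -> (p <= n)%nat -> exists C, 0 <= C /\
    forall y j, (j < p)%nat -> Rabs (B y i j) <= C).
  { intros i p Hi; induction p as [|p IH]; intros Hp.
    - exists 0; split; [lra | intros; lia].
    - destruct IH as (C & HC & K); [lia |].
      destruct (continuous_fun_bounded _ (B_cont i p Hi ltac:(lia))) as (C' & K').
      exists (Rmax C C'); split; [eapply Rle_trans; [exact HC | apply Rmax_l] |].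
      intros y j Hj; destruct (Nat.eq_dec j p) as [->|].
      + eapply Rle_trans; [apply K' | apply Rmax_r].
      + eapply Rle_trans; [apply K; lia | apply Rmax_l]. }
  assert (H2 : forall p, (p <= n)%nat -> exists C, 0 <= C /\
    forall y i j, (i < p)%nat -> (j < n)%nat -> Rabs (B y i j) <= C).
  { induction p as [|p IH]; intros Hp.
    - exists 0; split; [lra | intros; lia].
    - destruct IH as (C & HC & K); [lia |].
      destruct (H1 p n ltac:(lia) ltac:(lia)) as (C' & _ & K').
      exists (Rmax C C'); split; [eapply Rle_trans; [exact HC | apply Rmax_l] |].
      intros y i j Hi Hj; destruct (Nat.eq_dec i p) as [->|].
      + eapply Rle_trans; [apply K'; exact Hj | apply Rmax_r].
      + eapply Rle_trans; [apply K; [lia | exact Hj] | apply Rmax_l]. }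
  apply H2; lia.
Qed.

(** Since [s] and [t] may come in either order, this is also a lower bound; it makes a solution that
    vanishes once vanish always. *)
Lemma sol_growth : exists c, 0 <= c /\ forall y u s t, sol y u ->
  sqnorm n (u t) <= exp (c * Rabs (t - s)) * sqnorm n (u s).
Proof.
  destruct B_bounded as (C & HC & HB).
  exists (2 * INR n * C + 1); split.
  { pose proof (pos_INR n); assert (0 <= INR n * C) by (apply Rmult_le_pos; lra); lra. }
  intros y u s t Hu.
  pose proof (forced_growth n (fun r => B (fl (fl y s) r)) (fun r => u (s + r)) (fun _ _ => 0)
    C 0 (Rabs (t - s)) HC (Rle_refl 0)) as G.
  cbv beta in G.
  specialize (G ltac:(intros; rewrite Rplus_0_r; apply (sol_shift y u s Hu); assumption)
    ltac:(intros; apply HB; assumption) ltac:(intros; rewrite Rabs_R0; lra) (t - s) (Rle_refl _)).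
  rewrite Rplus_0_r in G; replace (s + (t - s)) with t in G by ring.
  lra.
Qed.

Lemma sol_nonzero y u s t : sol y u -> nonzero n (u s) -> nonzero n (u t).
Proof.
  rewrite !nonzero_sqnorm; intros Hu Hs.
  destruct sol_growth as (c & _ & G); specialize (G y u t s Hu).
  pose proof (exp_pos (c * Rabs (s - t))); pose proof (sqnorm_nonneg n (u t)); nra.
Qed.

Lemma B_flow_continuous y i j t : (i < n)%nat -> (j < n)%nat ->
  continuous_at (fun s => B (fl y s) i j) t.
Proof.
  intros Hi Hj eps He.
  destruct (B_cont i j Hi Hj (fl y t) eps He) as (r & Hr & K).
  destruct fl_flow as (_ & _ & F).
  destruct (F y t r Hr) as (dl & Hd & K').
  exists dl; split; [exact Hd |]; intros s Hs; apply K, K'; [| exact Hs].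
  destruct d_metric as (_ & D & _); rewrite (proj2 (D y y) eq_refl); exact Hd.
Qed.

Lemma flow_uniform f y T eps : is_continuous_fun d f -> 0 < eps ->
  exists delta, 0 < delta /\ forall z s, d y z < delta -> Rabs s <= T ->
    Rabs (f (fl z s) - f (fl y s)) < eps.
Proof.
  intros Hf He.
  destruct fl_flow as (_ & _ & F); destruct d_metric as (_ & D & _).
  assert (L : forall t, exists r : posreal, forall z s, d y z < r -> Rabs (s - t) < r ->
    Rabs (f (fl z s) - f (fl y t)) < eps / 2).
  { intros t; destruct (Hf (fl y t) (eps / 2) ltac:(lra)) as (r & Hr & K).
    destruct (F y t r Hr) as (r' & Hr' & K').
    exists (mkposreal r' Hr'); intros z s Hz Hs; apply K, K'; assumption. }
  set (rad := fun t => proj1_sig (constructive_indefinite_description _ (L t))).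
  assert (Hrad : forall t z s, d y z < rad t -> Rabs (s - t) < rad t ->
    Rabs (f (fl z s) - f (fl y t)) < eps / 2).
  { intros t; exact (proj2_sig (constructive_indefinite_description _ (L t))). }
  (* The cover of [[-T, T]] by the radii [rad t] yields a positive [dl] lying below [rad t] for some
     [t] close to any given [s]. Both values are then compared with [f (fl y t)], whence
     [eps / 2]. *)
  destruct (Coquelicot.Compactness.compactness_value_1d (- T) T rad) as (dl & K).
  exists dl; split; [apply cond_pos |]; intros z s Hz Hs.
  assert (Hs' : - T <= s <= T) by (unfold Rabs in Hs; destruct (Rcase_abs s); lra).
  destruct (NNPP _ (K s Hs')) as (t & _ & H1 & H2).
  pose proof (Hrad t z s ltac:(lra) H1) as E1.
  assert (Hy : d y y < rad t) by (rewrite (proj2 (D y y) eq_refl); apply cond_pos).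
  pose proof (Hrad t y s Hy H1) as E2.
  apply Rabs_def2 in E1; apply Rabs_def2 in E2; apply Rabs_def1; lra.
Qed.

Lemma B_flow_uniform y T eps : 0 < eps ->
  exists delta, 0 < delta /\ forall z s i j, d y z < delta -> Rabs s <= T ->
    (i < n)%nat -> (j < n)%nat -> Rabs (B (fl z s) i j - B (fl y s) i j) < eps.
Proof.
  intros He.
  destruct (finite_common_radius n (fun i h => forall j, (j < n)%nat -> forall z s, d y z < h ->
    Rabs s <= T -> Rabs (B (fl z s) i j - B (fl y s) i j) < eps)) as (r & Hr & K).
  - intros i Hi.
    destruct (finite_common_radius n (fun j h => forall z s, d y z < h ->
      Rabs s <= T -> Rabs (B (fl z s) i j - B (fl y s) i j) < eps)) as (r & Hr & K).
    + intros j Hj.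
      destruct (flow_uniform _ y T eps (B_cont i j Hi Hj) He) as (r & Hr & K).
      exists r; split; [exact Hr |]; intros h Hh z s Hz Hs.
      apply K; [| exact Hs]; pose proof (Rle_abs h); lra.
    + exists r; split; [exact Hr |]; intros h Hh j Hj; apply K; assumption.
  - exists (r / 2); split; [lra |]; intros z s i j Hz Hs Hi Hj.
    apply (K i (r / 2)); try assumption; rewrite Rabs_right; lra.
Qed.

(** The difference of the solutions satisfies the equation over [ys k] with forcing
    [(B (fl (ys k) s) - B (fl y s)) u], which is uniformly small for [Rabs s <= T]. *)
Lemma sol_continuous_dependence (ys : nat -> Y) (us : nat -> R -> nat -> R) y u :
  Un_cv (fun k => d y (ys k)) 0 -> (forall k, sol (ys k) (us k)) -> sol y u ->
  (forall i, (i < n)%nat -> Un_cv (fun k => us k 0 i) (u 0 i)) ->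
  forall t i, (i < n)%nat -> Un_cv (fun k => us k t i) (u t i).
Proof.
  intros Hy Hus Hu H0 t i Hi eps He.
  destruct B_bounded as (C & HC & HB).
  destruct sol_growth as (c & Hc & G).
  set (T := Rabs t).
  pose proof (Rabs_pos t) as HT; fold T in HT.
  pose proof (pos_INR n) as Pn.
  set (M := exp (c * T) * sqnorm n (u 0) + 1).
  assert (HM : 1 <= M).
  { unfold M; pose proof (exp_pos (c * T)); pose proof (sqnorm_nonneg n (u 0)).
    assert (0 <= exp (c * T) * sqnorm n (u 0)) by (apply Rmult_le_pos; lra); lra. }
  assert (Hbd : forall s j, Rabs s <= T -> (j < n)%nat -> Rabs (u s j) <= M).
  { intros s j Hs Hj; pose proof (G y u 0 s Hu) as Q; rewrite Rminus_0_r in Q.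
    assert (u s j ^ 2 <= M - 1).
    { eapply Rle_trans; [apply (sqr_le_sqnorm n (u s) j Hj) |].
      eapply Rle_trans; [exact Q |]; unfold M.
      assert (exp (c * Rabs s) <= exp (c * T)).
      { destruct (Rle_lt_or_eq_dec (c * Rabs s) (c * T)) as [L| ->].
        - apply Rmult_le_compat_l; assumption.
        - left; apply exp_increasing, L.
        - right; reflexivity. }
      pose proof (sqnorm_nonneg n (u 0)); nra. }
    apply Rabs_le; split; nra. }
  set (E := exp ((2 * INR n * C + 1) * T)).
  pose proof (exp_pos ((2 * INR n * C + 1) * T)) as PE; fold E in PE.
  (* Initial error and forcing each get [eps ^ 2 / 2] after amplification by [E]; using [INR n + 1]
     keeps the denominator positive. *)
  set (eta2 := eps ^ 2 / (2 * E * (INR n + 1))).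
  assert (Heta2 : 0 < eta2) by (apply Rdiv_lt_0_compat; [apply pow_lt, He | nra]).
  set (eta := sqrt eta2).
  assert (Heta : 0 < eta) by (apply sqrt_lt_R0, Heta2).
  destruct (B_flow_uniform y T (eta / ((INR n + 1) * M))) as (r & Hr & KB).
  { apply Rdiv_lt_0_compat; nra. }
  destruct (Hy r Hr) as (N1 & HN1).
  assert (W0 : Un_cv (fun k => sqnorm n (fun j => us k 0 j - u 0 j)) (sqnorm n (fun _ => 0))).
  { apply (Un_cv_sqnorm n (fun k j => us k 0 j - u 0 j)); intros j Hj.
    assert (Q : Un_cv (fun k => us k 0 j - u 0 j) (u 0 j - u 0 j)).
    { apply (CV_minus (fun k => us k 0 j) (fun _ => u 0 j)); [apply H0, Hj | apply Un_cv_const]. }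
    rewrite Rminus_diag in Q; exact Q. }
  assert (Z0 : sqnorm n (fun _ => 0) = 0).
  { unfold sqnorm; rewrite (sumn_ext n _ (fun _ => 0)) by (intros; ring).
    rewrite sumn_const; ring. }
  rewrite Z0 in W0.
  destruct (W0 (eps ^ 2 / (2 * E))) as (N2 & HN2).
  { apply Rdiv_lt_0_compat; [apply pow_lt, He | lra]. }
  exists (max N1 N2); intros k Hk.
  specialize (HN1 k ltac:(unfold ge in *; lia)); specialize (HN2 k ltac:(unfold ge in *; lia)).
  unfold Rdist in *; rewrite Rminus_0_r in HN1, HN2.
  assert (Hd : d y (ys k) < r) by (eapply Rle_lt_trans; [apply Rle_abs | exact HN1]).
  rewrite Rabs_right in HN2 by apply Rle_ge, sqnorm_nonneg.
  pose proof (forced_growth n (fun s => B (fl (ys k) s)) (fun s j => us k s j - u s j)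
    (fun s i => sumn n (fun j => (B (fl (ys k) s) i j - B (fl y s) i j) * u s j))
    C eta T HC ltac:(lra)) as F.
  cbv beta in F.
  assert (F' : sqnorm n (fun j => us k t j - u t j) <=
    (sqnorm n (fun j => us k 0 j - u 0 j) + INR n * eta ^ 2) * E).
  { apply F; [| | | apply Rle_refl].
    - intros s j Hj Hs.
      rewrite <- sumn_plus.
      rewrite (sumn_ext n _ (fun l => B (fl (ys k) s) j l * us k s l +
        (-1) * (B (fl y s) j l * u s l))) by (intros; ring).
      rewrite sumn_plus, sumn_scal.
      replace (-1 * sumn n (fun l => B (fl y s) j l * u s l))
        with (- sumn n (fun l => B (fl y s) j l * u s l)) by ring.
      apply (derivable_pt_lim_minus (fun s => us k s j) (fun s => u s j)); [apply Hus | apply Hu]; exact Hj.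
    - intros; apply HB; assumption.
    - intros s j Hj Hs.
      eapply Rle_trans; [apply sumn_abs |].
      apply Rle_trans with (sumn n (fun _ => eta / (INR n + 1))).
      + apply sumn_le; intros l Hl; rewrite Rabs_mult.
        replace (eta / (INR n + 1)) with (eta / ((INR n + 1) * M) * M) by (field; lra).
        apply Rmult_le_compat; try apply Rabs_pos; [| apply Hbd; assumption].
        left; apply KB; assumption.
      + rewrite sumn_const.
        apply Rle_trans with ((INR n + 1) * (eta / (INR n + 1))); [| right; field; lra].
        apply Rmult_le_compat_r; [left; apply Rdiv_lt_0_compat; lra | lra]. }
  assert (Sq : eta ^ 2 = eta2) by (unfold eta; apply pow2_sqrt; lra).
  rewrite Sq in F'.
  assert (P1 : sqnorm n (fun j => us k 0 j - u 0 j) * E < eps ^ 2 / 2).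
  { apply Rmult_lt_compat_r with (r := E) in HN2; [| exact PE].
    replace (eps ^ 2 / (2 * E) * E) with (eps ^ 2 / 2) in HN2 by (field; lra); exact HN2. }
  assert (P2 : INR n * eta2 * E <= eps ^ 2 / 2).
  { replace (eps ^ 2 / 2) with ((INR n + 1) * eta2 * E) by (unfold eta2; field; lra).
    assert (0 <= eta2 * E) by (apply Rmult_le_pos; lra); nra. }
  pose proof (sqr_le_sqnorm n (fun j => us k t j - u t j) i Hi) as P3; cbv beta in P3.
  assert (P4 : (us k t i - u t i) ^ 2 < eps ^ 2) by nra.
  rewrite <- (Rabs_right eps) by lra; apply Rsqr_lt_abs_0; unfold Rsqr; nra.
Qed.

Lemma compact_sequence (ys : nat -> Y) :
  exists phi y, (forall k, (k <= phi k)%nat) /\ Un_cv (fun k => d y (ys (phi k))) 0.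
Proof.
  destruct d_metric as (D0 & D1 & D2 & D3).
  assert (Cl : exists y, forall eps N, 0 < eps -> exists k, (N <= k)%nat /\ d y (ys k) < eps).
  { apply NNPP; intros C.
    (* Without a cluster point every point has a ball that the sequence leaves from some rank on.
       The index carries centre, radius and rank, so a finite subcover has a largest rank [K], and
       [ys K] lies in no ball. *)
    destruct (Y_compact (Y * (R * nat))%type (fun p z => d (fst p) z < fst (snd p) /\
      forall k, (snd (snd p) <= k)%nat -> ~ d (fst p) (ys k) < fst (snd p))) as (l & Hl).
    - intros (y0 & r & N) z (Hz & HN); simpl in *.
      exists (r - d y0 z); split; [lra |]; intros z' Hz'; split; [| exact HN].
      pose proof (D3 y0 z z'); lra.
    - intros y; apply NNPP; intros C'; apply C; exists y; intros eps N He.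
      apply NNPP; intros C''; apply C'; exists (y, (eps, N)); simpl; split.
      + rewrite (proj2 (D1 y y) eq_refl); exact He.
      + intros k Hk Hd; apply C''; exists k; auto.
    - set (K := list_max (map (fun p => snd (snd p)) l)).
      destruct (Hl (ys K)) as (p & Hp & H1 & H2).
      apply (H2 K); [| exact H1].
      pose proof (proj1 (list_max_le (map (fun p => snd (snd p)) l) K) (Nat.le_refl _)) as Q.
      rewrite Forall_forall in Q; apply Q, in_map_iff; exists p; auto. }
  destruct Cl as (y & Hy).
  destruct (extraction (fun k z => d y z < / INR (S k)) ys) as (phi & H1 & H2).
  { intros k N; apply Hy, Rinv_0_lt_compat, lt_0_INR; lia. }
  exists phi, y; split; [exact H1 |].
  intros eps He; destruct (inv_INR_eventually eps He) as (N & HN).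
  exists N; intros k Hk; unfold Rdist.
  rewrite Rminus_0_r, Rabs_right by apply Rle_ge, D0.
  eapply Rlt_trans; [apply H2 | apply HN, Hk].
Qed.

Definition converges (us : nat -> R -> nat -> R) (u : R -> nat -> R) : Prop :=
  forall t i, (i < n)%nat -> Un_cv (fun k => us k t i) (u t i).

Lemma sol_pair_compact (ys : nat -> Y) (us vs : nat -> R -> nat -> R) C :
  (forall k, sol (ys k) (us k)) -> (forall k, sol (ys k) (vs k)) ->
  (forall k, sqnorm n (us k 0) <= C) -> (forall k, sqnorm n (vs k 0) <= C) ->
  exists phi y u v, (forall k, (k <= phi k)%nat) /\ sol y u /\ sol y v /\
    converges (fun k => us (phi k)) u /\ converges (fun k => vs (phi k)) v.
Proof.
  intros Hu Hv Bu Bv.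
  assert (Bd : forall x i, sqnorm n x <= C -> (i < n)%nat -> Rabs (x i) <= C + 1).
  { intros x i Hx Hi; pose proof (sqr_le_sqnorm n x i Hi); apply Rabs_le; split; nra. }
  destruct (compact_sequence ys) as (f1 & y & F1 & Cy).
  destruct (bounded_vec_extract n (fun k => us (f1 k) 0) (C + 1)) as (f2 & u0 & F2 & Cu).
  { intros; apply Bd; auto. }
  destruct (bounded_vec_extract n (fun k => vs (f1 (f2 k)) 0) (C + 1)) as (f3 & v0 & F3 & Cv).
  { intros; apply Bd; auto. }
  assert (F23 : forall k, (k <= f2 (f3 k))%nat).
  { intros k; specialize (F2 (f3 k)); specialize (F3 k); lia. }
  assert (Cy' : Un_cv (fun k => d y (ys (f1 (f2 (f3 k))))) 0).
  { apply (Un_cv_extract (fun k => d y (ys (f1 k))) 0 (fun k => f2 (f3 k))); assumption. }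
  exists (fun k => f1 (f2 (f3 k))), y, (fun t => mat_vec n (Phi t y) u0), (fun t => mat_vec n (Phi t y) v0).
  split; [intros k; specialize (F1 (f2 (f3 k))); specialize (F23 k); lia |].
  split; [apply sol_Phi |]; split; [apply sol_Phi |]; split.
  - intros t i Hi.
    apply (sol_continuous_dependence (fun k => ys (f1 (f2 (f3 k)))) (fun k => us (f1 (f2 (f3 k)))) y
      (fun t => mat_vec n (Phi t y) u0));
      [exact Cy' | auto | apply sol_Phi | | exact Hi].
    intros j Hj; rewrite Phi_0 by exact Hj.
    apply (Un_cv_extract (fun k => us (f1 (f2 k)) 0 j) (u0 j) f3 F3), Cu, Hj.
  - intros t i Hi.
    apply (sol_continuous_dependence (fun k => ys (f1 (f2 (f3 k)))) (fun k => vs (f1 (f2 (f3 k)))) y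
      (fun t => mat_vec n (Phi t y) v0));
      [exact Cy' | auto | apply sol_Phi | | exact Hi].
    intros j Hj; rewrite Phi_0 by exact Hj; apply Cv, Hj.
Qed.

(** * Comparison of the two bundles *)

Hypothesis Hn : (2 <= n)%nat.
Hypothesis B_tridiag : forall y, tridiag_pos n (B y).

Lemma Lambda_limit (zs : nat -> nat -> R) z : in_Lambda n z ->
  (forall i, (i < n)%nat -> Un_cv (fun k => zs k i) (z i)) ->
  exists N, forall k, (N <= k)%nat -> in_Lambda n (zs k) /\ sigma n (zs k) = sigma n z.
Proof.
  intros HL Hc.
  destruct (eventually_forall n (fun i k => z i <> 0 -> 0 < z i * zs k i)) as (N & K).
  - intros i Hi; destruct (Req_EM_T (z i) 0) as [E|E].
    + exists 0%nat; intros; contradiction.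
    + destruct (Hc i Hi (Rabs (z i)) (Rabs_pos_lt _ E)) as (N & K); exists N; intros k Hk _.
      specialize (K k Hk); unfold Rdist in K; unfold Rabs in K.
      destruct (Rcase_abs (zs k i - z i)), (Rcase_abs (z i)); nra.
  - exists N; intros k Hk; apply Lambda_same_signs; auto.
Qed.

Lemma Lambda_scal c z : c <> 0 -> in_Lambda n z ->
  in_Lambda n (fun i => c * z i) /\ sigma n (fun i => c * z i) = sigma n z.
Proof.
  intros Hc (H1 & H2 & H3).
  assert (C2 : 0 < c * c) by nra.
  split.
  - split; [nra |]; split; [nra |].
    intros i Hi1 Hi2 E; specialize (H3 i Hi1 Hi2 ltac:(nra)); nra.
  - apply count_upto_ext; intros i _; unfold sc_indicator.
    destruct (Req_EM_T (c * z i) 0), (Req_EM_T (z i) 0); try (exfalso; nra); [reflexivity |].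
    destruct (Rlt_dec (c * z i * (c * z (S i))) 0), (Rlt_dec (z i * z (S i)) 0);
      try reflexivity; exfalso; nra.
Qed.

Lemma Lambda_unscal c z : c <> 0 -> in_Lambda n (fun i => c * z i) ->
  in_Lambda n z /\ sigma n (fun i => c * z i) = sigma n z.
Proof.
  intros Hc (H1 & H2 & H3).
  assert (C2 : 0 < c * c) by nra.
  assert (L : in_Lambda n z).
  { split; [nra |]; split; [nra |].
    intros i Hi1 Hi2 E; specialize (H3 i Hi1 Hi2 ltac:(nra)); nra. }
  split; [exact L | apply Lambda_scal; assumption].
Qed.

Lemma Lambda_ext z z' : in_Lambda n z -> (forall i, (i < n)%nat -> z i = z' i) ->
  in_Lambda n z' /\ sigma n z' = sigma n z.
Proof.
  intros HL E; apply Lambda_same_signs; auto.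
  intros i Hi Hz; rewrite <- E by exact Hi; nra.
Qed.

Lemma sol_Lambda_time y u a b : sol y u -> nonzero n (u 0) -> a < b ->
  exists t, a < t < b /\ in_Lambda n (u t).
Proof.
  intros Hu Hz Hab.
  set (c := (a + b) / 2).
  destruct (solution_Lambda_near n (fun t => B (fl y t)) u Hn) with (t := c) as (r & Hr & K).
  - intros; apply B_tridiag.
  - intros; apply B_flow_continuous; assumption.
  - exact Hu.
  - apply (sol_nonzero y u 0); assumption.
  - pose proof (Rmin_l r (b - c)); pose proof (Rmin_r r (b - c)).
    assert (0 < Rmin r (b - c)) by (apply Rmin_pos; unfold c in *; lra).
    exists (c + Rmin r (b - c) / 2); split.
    + unfold c in *; split; lra.
    + apply K; rewrite Rabs_right; unfold c in *; lra.
Qed.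

Lemma sol_sigma_decreasing y u a b : sol y u -> a < b ->
  in_Lambda n (u a) -> in_Lambda n (u b) -> (sigma n (u b) <= sigma n (u a))%nat.
Proof.
  intros Hu Hab La Lb.
  apply (sigma_decreasing n (fun t => B (fl y t)) u Hn); auto.
  - intros; apply B_flow_continuous; assumption.
  - intros t; apply (sol_nonzero y u a); [exact Hu | apply in_Lambda_nonzero; assumption].
Qed.

(** The form in which the bundles enter. Such a condition passes to limits of solutions, time shifts
    and nonzero multiples, so compactness applies to pairs of solutions without reference to the
    fibres. *)
Definition obeys (Q : nat -> Prop) (u : R -> nat -> R) : Prop :=
  forall t, in_Lambda n (u t) -> Q (sigma n (u t)).

Lemma obeys_limit Q us u : converges us u -> (forall k, obeys Q (us k)) -> obeys Q u.
Proof.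
  intros C H t L.
  destruct (Lambda_limit (fun k => us k t) (u t) L) as (N & K); [intros; apply C; assumption |].
  destruct (K N (Nat.le_refl N)) as (K1 & <-); apply H, K1.
Qed.

Lemma obeys_rescale Q u c s : c <> 0 -> obeys Q u -> obeys Q (fun t i => c * u (s + t) i).
Proof.
  intros Hc H t L; destruct (Lambda_unscal c (u (s + t)) Hc L) as (L' & ->); apply H, L'.
Qed.

Lemma sol_rescale y u c s : sol y u -> sol (fl y s) (fun t i => c * u (s + t) i).
Proof. intros Hu; apply (sol_scal (fl y s) (fun t => u (s + t))), sol_shift, Hu. Qed.

Lemma sol_zero y u : sol y u -> sqnorm n (u 0) = 0 -> forall t i, (i < n)%nat -> u t i = 0.
Proof.
  intros Hu H0 t i Hi; apply NNPP; intros E.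
  assert (Z : nonzero n (u 0)) by (apply (sol_nonzero y u t); [exact Hu | exists i; auto]).
  apply nonzero_sqnorm in Z; lra.
Qed.

(** In the limit the perturbation disappears. The limit solution obeys [Q] at some time [t] in
    Lambda, and there local constancy of [sigma] carries [Q] back to the perturbed states of large
    index. *)
Lemma perturbed_obeys Q (ys : nat -> Y) (us vs : nat -> R -> nat -> R) a b : a < b ->
  (forall k, sol (ys k) (us k)) -> (forall k, sol (ys k) (vs k)) ->
  (forall k, sqnorm n (us k 0) = 1) -> (forall k, sqnorm n (vs k 0) <= / INR (S k)) ->
  (forall k, obeys Q (us k)) ->
  exists phi, (forall k, (k <= phi k)%nat) /\ forall k, exists t, a < t < b /\
    let z := fun i => us (phi k) t i + vs (phi k) t i in in_Lambda n z /\ Q (sigma n z).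
Proof.
  intros Hab Hu Hv Nu Nv HQ.
  assert (Inv1 : forall k, / INR (S k) <= 1).
  { intros k; rewrite <- Rinv_1; apply Rinv_le_contravar; [lra |].
    rewrite <- INR_1; apply le_INR; lia. }
  destruct (sol_pair_compact ys us vs 1 Hu Hv) as (phi & y & u & v & Hphi & Su & Sv & Cu & Cv).
  { intros k; rewrite Nu; lra. }
  { intros k; specialize (Nv k); specialize (Inv1 k); lra. }
  assert (Nu0 : sqnorm n (u 0) = 1).
  { apply (UL_sequence (fun k => sqnorm n (us (phi k) 0))).
    - apply Un_cv_sqnorm; intros; apply Cu; assumption.
    - apply (Un_cv_ext (fun _ => 1)); [intros; rewrite Nu; reflexivity | apply Un_cv_const]. }
  assert (Nv0 : sqnorm n (v 0) = 0).
  { apply (UL_sequence (fun k => sqnorm n (vs (phi k) 0))).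
    - apply Un_cv_sqnorm; intros; apply Cv; assumption.
    - intros eps He; destruct (inv_INR_eventually eps He) as (N & K); exists N; intros k Hk.
      unfold Rdist; rewrite Rminus_0_r, Rabs_right by apply Rle_ge, sqnorm_nonneg.
      eapply Rle_lt_trans; [apply Nv |]; apply K; specialize (Hphi k); unfold ge in Hk; lia. }
  destruct (sol_Lambda_time y u a b Su) as (t & Ht & Lt); [| exact Hab |].
  { apply nonzero_sqnorm; lra. }
  pose proof (obeys_limit Q _ u Cu (fun k => HQ (phi k)) t Lt) as Qt.
  destruct (Lambda_limit (fun k i => us (phi k) t i + vs (phi k) t i) (u t) Lt) as (N & K).
  { intros i Hi; rewrite <- (Rplus_0_r (u t i)), <- (sol_zero y v Sv Nv0 t i Hi).
    apply (CV_plus (fun k => us (phi k) t i) (fun k => vs (phi k) t i)); [apply Cu | apply Cv]; exact Hi. }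
  exists (fun k => phi (k + N)%nat); split.
  - intros k; specialize (Hphi (k + N)%nat); lia.
  - intros k; exists t; split; [exact Ht |]; simpl.
    destruct (K (k + N)%nat ltac:(lia)) as (K1 & K2); rewrite K2; auto.
Qed.

(** * Pairs of solutions from the two bundles and the ratio of their norms *)

Variable m : nat.

Definition admissible (y : Y) (u v : R -> nat -> R) : Prop :=
  sol y u /\ sol y v /\ nonzero n (u 0) /\ nonzero n (v 0) /\
  obeys (fun q => (q <= m)%nat) u /\ obeys (fun q => (m < q)%nat) v.

Lemma admissible_rescale y u v a b s : a <> 0 -> b <> 0 -> admissible y u v ->
  admissible (fl y s) (fun t i => a * u (s + t) i) (fun t i => b * v (s + t) i).
Proof.
  intros Ha Hb (Su & Sv & Zu & Zv & Ou & Ov).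
  assert (R : forall w c, sol y w -> nonzero n (w 0) -> c <> 0 -> nonzero n (fun i => c * w (s + 0) i)).
  { intros w c Sw Zw Hc; destruct (sol_nonzero y w 0 (s + 0) Sw Zw) as (i & Hi & E).
    exists i; split; [exact Hi | apply Rmult_integral_contrapositive; auto]. }
  repeat split; try (apply sol_rescale; assumption); try (apply R; assumption);
    apply obeys_rescale; assumption.
Qed.

Lemma admissible_pos y u v t : admissible y u v -> 0 < sqnorm n (u t) /\ 0 < sqnorm n (v t).
Proof.
  intros (Su & Sv & Zu & Zv & _); split; apply nonzero_sqnorm;
    [apply (sol_nonzero y u 0) | apply (sol_nonzero y v 0)]; assumption.
Qed.

(** A relation with both coefficients nonzero would make [v] a multiple of [u], with as many sign
    changes: at most [m] and more than [m]. *)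
Lemma admissible_independent y u v a b t : admissible y u v -> a <> 0 \/ b <> 0 ->
  nonzero n (fun i => a * u t i + b * v t i).
Proof.
  intros H Hab.
  destruct H as (Su & Sv & Zu & Zv & Ou & Ov).
  set (w := fun t i => a * u t i + b * v t i).
  assert (Sw : sol y w) by (apply sol_lincomb; assumption).
  apply NNPP; intros C.
  assert (W0 : forall s i, (i < n)%nat -> w s i = 0).
  { intros s i Hi; apply NNPP; intros E; apply C.
    apply (sol_nonzero y w s t Sw); exists i; auto. }
  destruct (sol_Lambda_time y u 0 1 Su Zu ltac:(lra)) as (r & _ & Lr).
  destruct (Req_EM_T b 0) as [->|Hb].
  - destruct Lr as (L0 & _); specialize (W0 r 0%nat ltac:(lia)); unfold w in W0; nra.
  - destruct (Req_EM_T a 0) as [->|Ha].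
    + destruct (sol_Lambda_time y v 0 1 Sv Zv ltac:(lra)) as (r' & _ & L0 & _).
      specialize (W0 r' 0%nat ltac:(lia)); unfold w in W0; nra.
    + destruct (Lambda_scal (- a / b) (u r)) as (L1 & S1); [| exact Lr |].
      { intros E; apply Ha; apply Rmult_eq_compat_r with (r := - b) in E.
        replace (- a / b * - b) with a in E by (field; exact Hb); lra. }
      destruct (Lambda_ext (fun i => - a / b * u r i) (v r) L1) as (L2 & S2).
      { intros i Hi; specialize (W0 r i Hi); unfold w in W0.
        apply Rmult_eq_reg_l with b; [| exact Hb].
        replace (b * (- a / b * u r i)) with (- a * u r i) by (field; exact Hb); lra. }
      pose proof (Ou r Lr) as Q1; pose proof (Ov r L2) as Q2; cbv beta in Q1, Q2; lia.
Qed.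

Definition ratio (u v : R -> nat -> R) (t : R) : R := sqnorm n (v t) / sqnorm n (u t).

(* If the ratio grew too much, a combination of [u] and [v] would have at most
   [m] sign changes near time [0], where [u] dominates, and more than [m] near
   time [t], where [v] dominates. *)
Lemma ratio_bound : exists M, 1 <= M /\ forall y u v t, admissible y u v -> 2 <= t ->
  ratio u v t <= M * ratio u v 0.
Proof.
  apply NNPP; intros C.
  (* The fourth power is shared out: with [K = INR (S k)], the subordinate term of the combination
     then has squared norm at most [/ K ^ 2] relative to the dominant one, both at time [0] and at
     time [t]. *)
  destruct (seq_choice (fun k (p : Y * (R -> nat -> R) * (R -> nat -> R) * R) =>
    let '(y, u, v, t) := p in admissible y u v /\ 2 <= t /\
      INR (S k) ^ 4 * ratio u v 0 < ratio u v t)) as (f & Hf).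
  { intros k; apply NNPP; intros C'; apply C; exists (INR (S k) ^ 4); split.
    - apply pow_R1_Rle; rewrite <- INR_1; apply le_INR; lia.
    - intros y u v t H Ht; apply Rnot_lt_le; intros Hl; apply C'; exists (y, u, v, t); auto. }
  set (yk := fun k => fst (fst (fst (f k)))).
  set (uk := fun k => snd (fst (fst (f k)))).
  set (vk := fun k => snd (fst (f k))).
  set (tk := fun k => snd (f k)).
  assert (H : forall k, admissible (yk k) (uk k) (vk k) /\ 2 <= tk k /\
    INR (S k) ^ 4 * ratio (uk k) (vk k) 0 < ratio (uk k) (vk k) (tk k)).
  { intros k; specialize (Hf k); unfold yk, uk, vk, tk; destruct (f k) as [[[y u] v] t]; exact Hf. }
  clearbody yk uk vk tk; clear f Hf C.
  set (a := fun k => sqrt (sqnorm n (uk k 0))).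
  set (b := fun k => sqrt (sqnorm n (vk k 0))).
  set (c := fun k => sqrt (sqnorm n (vk k (tk k)))).
  assert (Pos : forall k, 0 < a k /\ 0 < b k /\ 0 < c k /\ 1 <= INR (S k)).
  { intros k; destruct (H k) as (Hk & _).
    pose proof (admissible_pos _ _ _ 0 Hk); pose proof (admissible_pos _ _ _ (tk k) Hk).
    repeat split; try (apply sqrt_lt_R0; tauto).
    rewrite <- INR_1; apply le_INR; lia. }
  assert (Sq : forall k, a k ^ 2 = sqnorm n (uk k 0) /\ b k ^ 2 = sqnorm n (vk k 0) /\
    c k ^ 2 = sqnorm n (vk k (tk k))).
  { intros k; unfold a, b, c; repeat split; apply pow2_sqrt, sqnorm_nonneg. }
  (* The combination is [u / a + v / (b * K)], with [u] of norm one at time [0]. *)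
  destruct (perturbed_obeys (fun q => (q <= m)%nat) yk
    (fun k s i => / a k * uk k s i) (fun k s i => / (b k * INR (S k)) * vk k s i) 0 1)
    as (phi & Hphi & K1); try lra.
  { intros k; apply sol_scal, H. }
  { intros k; apply sol_scal, H. }
  { intros k; destruct (Pos k) as (Pa & _), (Sq k) as (Sa & _).
    rewrite sqnorm_scal, <- Sa; field; lra. }
  { intros k; destruct (Pos k) as (Pa & Pb & Pc & Pk), (Sq k) as (Sa & Sb & Sc).
    rewrite sqnorm_scal, <- Sb.
    replace ((/ (b k * INR (S k))) ^ 2 * b k ^ 2) with (/ INR (S k) * / INR (S k))
      by (field; lra).
    assert (0 < / INR (S k)) by (apply Rinv_0_lt_compat; lra).
    assert (/ INR (S k) <= 1) by (rewrite <- Rinv_1; apply Rinv_le_contravar; lra).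
    nra. }
  { intros k; destruct (Pos k) as (Pa & _).
    intros s L; destruct (Lambda_unscal (/ a k) (uk k s)) as (L' & ->);
      [apply Rinv_neq_0_compat; lra | exact L | apply H, L']. }
  (* The same combination times [K * b / c], so that [v] has norm one at time [t]. The windows
     [(0, 1)] and [(t - 1, t)] are disjoint and ordered because [t >= 2]. *)
  destruct (perturbed_obeys (fun q => (m < q)%nat) (fun k => fl (yk (phi k)) (tk (phi k)))
    (fun k s i => / c (phi k) * vk (phi k) (tk (phi k) + s) i)
    (fun k s i => INR (S (phi k)) * b (phi k) / (a (phi k) * c (phi k)) *
      uk (phi k) (tk (phi k) + s) i) (-1) 0) as (psi & Hpsi & K2); try lra.
  { intros k; apply sol_rescale, H. }
  { intros k; apply sol_rescale, H. }
  { intros k'; set (k := phi k'); destruct (Pos k) as (Pa & Pb & Pc & Pk), (Sq k) as (Sa & Sb & Sc).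
    rewrite sqnorm_scal, Rplus_0_r, <- Sc; field; lra. }
  { intros k'; assert (Hk := Hphi k'); set (k := phi k') in *.
    destruct (Pos k) as (Pa & Pb & Pc & Pk), (Sq k) as (Sa & Sb & Sc).
    destruct (H k) as (Ad & _ & Hr).
    destruct (admissible_pos _ _ _ (tk k) Ad) as (Pu & _).
    rewrite sqnorm_scal, Rplus_0_r.
    unfold ratio in Hr; rewrite <- Sa, <- Sb, <- Sc in Hr.
    set (N := sqnorm n (uk k (tk k))) in *.
    set (K := INR (S k)) in *.
    (* Smallness is required in terms of the index [k'] of the extracted sequence, and
       [k = phi k' >= k']. *)
    assert (I1 : / K <= / INR (S k')) by (apply Rinv_le_contravar; [apply lt_0_INR; lia | apply le_INR; lia]).
    assert (Hr' : K ^ 4 * b k ^ 2 * N < c k ^ 2 * a k ^ 2).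
    { apply Rmult_lt_compat_r with (r := N * a k ^ 2) in Hr; [| apply Rmult_lt_0_compat; nra].
      replace (K ^ 4 * (b k ^ 2 / a k ^ 2) * (N * a k ^ 2)) with (K ^ 4 * b k ^ 2 * N) in Hr by (field; lra).
      replace (c k ^ 2 / N * (N * a k ^ 2)) with (c k ^ 2 * a k ^ 2) in Hr by (field; lra).
      exact Hr. }
    assert (G : (K * b k / (a k * c k)) ^ 2 * N <= / K ^ 2).
    { replace ((K * b k / (a k * c k)) ^ 2 * N)
        with (K ^ 4 * b k ^ 2 * N * (/ (K ^ 2 * (c k ^ 2 * a k ^ 2)))) by (field; lra).
      replace (/ K ^ 2) with (c k ^ 2 * a k ^ 2 * / (K ^ 2 * (c k ^ 2 * a k ^ 2))) by (field; lra).
      apply Rmult_le_compat_r; [| lra].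
      left; apply Rinv_0_lt_compat; repeat apply Rmult_lt_0_compat; lra. }
    assert (I2 : / K ^ 2 <= / K) by (apply Rinv_le_contravar; nra).
    lra. }
  { intros k; apply obeys_rescale; [| apply H].
    destruct (Pos (phi k)) as (_ & _ & Pc & _); apply Rinv_neq_0_compat; lra. }
  destruct (K1 (psi 0%nat)) as (s & Hs & L1 & O1).
  destruct (K2 0%nat) as (s' & Hs' & L2 & O2).
  set (k := phi (psi 0%nat)) in *.
  destruct (Pos k) as (Pa & Pb & Pc & Pk).
  destruct (H k) as ((Su & Sv & _) & Ht & _).
  set (w := fun r i => / a k * uk k r i + / (b k * INR (S k)) * vk k r i).
  assert (Sw : sol (yk k) w) by (apply sol_lincomb; assumption).
  destruct (Lambda_ext _ (fun i => INR (S k) * b k / c k * w (tk k + s') i)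
    L2 ltac:(intros; unfold w; field; lra)) as (L3 & S3).
  destruct (Lambda_unscal (INR (S k) * b k / c k) (w (tk k + s'))) as (L4 & S4); [| exact L3 |].
  { apply Rgt_not_eq, Rdiv_lt_0_compat; [apply Rmult_lt_0_compat; lra | lra]. }
  pose proof (sol_sigma_decreasing (yk k) w s (tk k + s') Sw ltac:(lra) L1 L4) as D.
  unfold w in D at 2; cbv beta in O1; lia.
Qed.

Lemma ratio_shift u v a b s t :
  ratio (fun t i => a * u (s + t) i) (fun t i => b * v (s + t) i) t =
  b ^ 2 / a ^ 2 * ratio u v (s + t).
Proof.
  unfold ratio; rewrite !sqnorm_scal; unfold Rdiv; rewrite Rinv_mult; ring.
Qed.

Lemma ratio_bound_between : exists M, 1 <= M /\ forall y u v s t, admissible y u v -> s + 2 <= t ->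
  ratio u v t <= M * ratio u v s.
Proof.
  destruct ratio_bound as (M & HM & K); exists M; split; [exact HM |].
  intros y u v s t H Hst.
  pose proof (K _ _ _ (t - s) (admissible_rescale y u v 1 1 s ltac:(lra) ltac:(lra) H) ltac:(lra)) as Q.
  rewrite !ratio_shift, Rplus_0_r in Q.
  replace (s + (t - s)) with t in Q by ring; lra.
Qed.

(** Going back in time [sigma] can only rise, and it is at most [n]. The induction says that either
    it settles or it reaches every level [j]; level [S n] is impossible. *)
Lemma sigma_eventually_constant_backward y w : sol y w -> nonzero n (w 0) ->
  exists q t0, forall t, t < t0 -> in_Lambda n (w t) -> sigma n (w t) = q.
Proof.
  intros Sw Zw.
  assert (Bd : forall t, (sigma n (w t) <= n)%nat).
  { intros t; unfold sigma.
    assert (G : forall k, (count_upto k (sc_indicator (w t)) <= k)%nat).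
    { induction k; simpl; [lia |].
      assert (sc_indicator (w t) k <= 1)%nat; [| lia].
      unfold sc_indicator; destruct (Req_EM_T (w t k) 0); [lia |].
      destruct (Rlt_dec (w t k * w t (S k)) 0); lia. }
    specialize (G (n - 1)%nat); lia. }
  assert (Ind : forall j, (exists q t0, forall t, t < t0 -> in_Lambda n (w t) -> sigma n (w t) = q) \/
    exists t, in_Lambda n (w t) /\ (j <= sigma n (w t))%nat).
  { induction j as [|j [IH|(t & Lt & Ht)]].
    - destruct (sol_Lambda_time y w 0 1 Sw Zw ltac:(lra)) as (t & _ & Lt); right; exists t; split; [exact Lt | lia].
    - left; exact IH.
    - destruct (classic (exists s, s < t /\ in_Lambda n (w s) /\ sigma n (w s) <> sigma n (w t)))
        as [(s & Hs & Ls & E)|C].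
      + right; exists s; split; [exact Ls |].
        pose proof (sol_sigma_decreasing y w s t Sw Hs Ls Lt); lia.
      + left; exists (sigma n (w t)), t; intros s Hs Ls; apply NNPP; intros E; apply C; exists s; auto. }
  destruct (Ind (S n)) as [Q|(t & _ & Q)]; [exact Q |].
  specialize (Bd t); lia.
Qed.

(* In the limit [t -> -oo] every combination of [u] and [v] acquires a constant
   number of sign changes, which by connectedness is the same for all of them. *)
Lemma no_bounded_ratio y u v M : admissible y u v -> 0 < M ->
  (forall t, sqnorm n (v t) <= M * sqnorm n (u t)) ->
  (forall t, sqnorm n (u t) <= M * sqnorm n (v t)) -> False.
Proof.
  intros H HM B1 B2.
  (* One common factor for [u] and [v], so that rescaling respects combinations with fixed
     coefficients; the two-sided bound keeps [v] from degenerating in the limit. *)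
  set (r := fun k => / sqrt (sqnorm n (u (- INR k)))).
  assert (Pr : forall k, 0 < r k).
  { intros k; apply Rinv_0_lt_compat, sqrt_lt_R0; apply (admissible_pos y u v _ H). }
  assert (Sr : forall k, r k ^ 2 * sqnorm n (u (- INR k)) = 1).
  { intros k; unfold r.
    assert (P : 0 < sqnorm n (u (- INR k))) by apply (admissible_pos y u v _ H).
    rewrite pow_inv, pow2_sqrt by lra; field; lra. }
  set (us := fun k t i => r k * u (- INR k + t) i).
  set (vs := fun k t i => r k * v (- INR k + t) i).
  assert (Ad : forall k, admissible (fl y (- INR k)) (us k) (vs k)).
  { intros k; specialize (Pr k); apply admissible_rescale; auto; lra. }
  assert (Nu : forall k, sqnorm n (us k 0) = 1).
  { intros k; unfold us; rewrite sqnorm_scal, Rplus_0_r; apply Sr. }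
  assert (Nv : forall k, sqnorm n (vs k 0) <= M /\ 1 <= M * sqnorm n (vs k 0)).
  { intros k; unfold vs; rewrite sqnorm_scal, Rplus_0_r.
    specialize (B1 (- INR k)); specialize (B2 (- INR k)); specialize (Sr k).
    assert (0 < r k ^ 2) by apply pow_lt, Pr.
    split; nra. }
  destruct (sol_pair_compact (fun k => fl y (- INR k)) us vs (Rmax 1 M))
    as (phi & y' & u' & v' & Hphi & Su & Sv & Cu & Cv).
  { intros; apply Ad. }
  { intros; apply Ad. }
  { intros k; rewrite Nu; apply Rmax_l. }
  { intros k; eapply Rle_trans; [apply Nv | apply Rmax_r]. }
  assert (Ad' : admissible y' u' v').
  { repeat split; try assumption.
    - apply nonzero_sqnorm.
      replace (sqnorm n (u' 0)) with 1; [lra |].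
      apply (UL_sequence (fun k => sqnorm n (us (phi k) 0))).
      + apply (Un_cv_ext (fun _ => 1)); [intros; rewrite Nu; reflexivity | apply Un_cv_const].
      + apply Un_cv_sqnorm; intros; apply Cu; assumption.
    - apply nonzero_sqnorm.
      assert (Q : 1 - M * sqnorm n (v' 0) <= 0).
      { apply (Un_cv_le_limit (fun k => 1 - M * sqnorm n (vs (phi k) 0))).
        - apply (CV_minus (fun _ => 1) (fun k => M * sqnorm n (vs (phi k) 0))); [apply Un_cv_const |].
          apply (CV_mult (fun _ => M)); [apply Un_cv_const |].
          apply Un_cv_sqnorm; intros; apply Cv; assumption.
        - exists 0%nat; intros k _; pose proof (proj2 (Nv (phi k))); lra. }
      pose proof (sqnorm_nonneg n (v' 0)); nra.
    - apply (obeys_limit _ _ u' Cu); intros k; apply (Ad (phi k)).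
    - apply (obeys_limit _ _ v' Cv); intros k; apply (Ad (phi k)). }
  (* The segment from [u'] to [v']; by independence it avoids zero. *)
  set (w := fun l t i => (1 - l) * u' t i + l * v' t i).
  assert (Ne : forall l, 1 - l <> 0 \/ l <> 0).
  { intros l; destruct (Req_EM_T l 0); [left; lra | right; assumption]. }
  assert (Sw : forall l, sol y' (w l)) by (intros; apply sol_lincomb; assumption).
  assert (Zw : forall l, nonzero n (w l 0)).
  { intros l; apply (admissible_independent y' u' v'); auto. }
  (* The combination of the original pair with the same [l] has a final value of [sigma] at [-oo],
     and every time of the limit orbit is a limit of times tending to [-oo]. *)
  assert (Cst : forall l, exists q, obeys (fun p => p = q) (w l)).
  { intros l.
    set (w0 := fun t i => (1 - l) * u t i + l * v t i).
    destruct (sigma_eventually_constant_backward y w0) as (q & t0 & K).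
    { apply sol_lincomb; apply H. }
    { apply (admissible_independent y u v); auto. }
    exists q; intros t Lt.
    destruct (Lambda_limit (fun k i => (1 - l) * us (phi k) t i + l * vs (phi k) t i) (w l t) Lt)
      as (N & HN).
    { intros i Hi; apply (CV_plus (fun k => (1 - l) * us (phi k) t i) (fun k => l * vs (phi k) t i)).
      - apply (CV_mult (fun _ => 1 - l)); [apply Un_cv_const | apply Cu, Hi].
      - apply (CV_mult (fun _ => l)); [apply Un_cv_const | apply Cv, Hi]. }
    destruct (INR_unbounded (t - t0)) as (N' & HN').
    destruct (HN (max N N') ltac:(lia)) as (L1 & <-).
    set (k := phi (max N N')) in *.
    assert (Hk : INR N' <= INR k) by (apply le_INR; unfold k; specialize (Hphi (max N N')); lia).
    destruct (Lambda_ext _ (fun i => r k * w0 (- INR k + t) i)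
      L1 ltac:(intros; unfold us, vs, w0; ring)) as (L2 & <-).
    destruct (Lambda_unscal (r k) (w0 (- INR k + t))) as (L3 & ->); [| exact L2 |].
    { specialize (Pr k); lra. }
    apply K; [lra | exact L3]. }
  set (g := fun l => proj1_sig (constructive_indefinite_description _ (Cst l))).
  assert (Hg : forall l, obeys (fun p => p = g l) (w l)).
  { intros l; exact (proj2_sig (constructive_indefinite_description _ (Cst l))). }
  (* One inequality is enough, since [g 0 <= m < g 1]. It follows because [g] is locally constant in
     [l]. *)
  assert (Mono : (g 1%R <= g 0%R)%nat).
  { apply (local_to_global_decreasing (fun _ => True)); [| lra | exact I | exact I].
    intros l.
    (* A single time in Lambda determines [g l], and at this time the signs persist for nearby
       [l]. *)
    destruct (sol_Lambda_time y' (w l) 0 1 (Sw l) (Zw l) ltac:(lra)) as (t & _ & Lt).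
    destruct (finite_common_radius n (fun i h => w l t i <> 0 -> 0 < w l t i * w (l + h) t i))
      as (dl & Hd & K).
    { intros i Hi; destruct (Req_EM_T (w l t i) 0) as [E|E].
      - exists 1; split; [lra | intros; contradiction].
      - set (D := Rabs (v' t i - u' t i) + 1).
        assert (HD : 0 < D) by (unfold D; pose proof (Rabs_pos (v' t i - u' t i)); lra).
        pose proof (Rabs_pos_lt _ E) as PE.
        exists (Rabs (w l t i) / D); split; [apply Rdiv_lt_0_compat; lra |].
        intros h Hh _.
        assert (Q : w (l + h) t i = w l t i + h * (v' t i - u' t i)) by (unfold w; ring).
        assert (Q' : Rabs (h * (v' t i - u' t i)) < Rabs (w l t i)).
        { rewrite Rabs_mult.
          apply Rle_lt_trans with (Rabs h * D).
          - apply Rmult_le_compat_l; [apply Rabs_pos | unfold D; lra].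
          - apply Rmult_lt_compat_r with (r := D) in Hh; [| exact HD].
            replace (Rabs (w l t i) / D * D) with (Rabs (w l t i)) in Hh by (field; lra); exact Hh. }
        rewrite Q; set (e := h * (v' t i - u' t i)) in *; set (z := w l t i) in *.
        unfold Rabs in Q'; destruct (Rcase_abs e), (Rcase_abs z); nra. }
    assert (Loc : forall h, Rabs h < dl -> g (l + h) = g l).
    { intros h Hh.
      destruct (Lambda_same_signs n (w l t) (w (l + h) t) Hn Lt) as (L1 & S1).
      { intros i Hi; apply K; assumption. }
      rewrite <- (Hg _ _ L1), <- (Hg _ _ Lt); exact S1. }
    exists dl; split; [exact Hd |]; split; [auto |].
    intros a b Ha Hab Hb _ _.
    replace a with (l + (a - l)) by ring; replace b with (l + (b - l)) by ring.
    rewrite !Loc by (apply Rabs_def1; lra); lia. }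
  assert (E0 : (g 0%R <= m)%nat).
  { destruct (sol_Lambda_time y' (w 0) 0 1 (Sw 0) (Zw 0) ltac:(lra)) as (t & _ & Lt).
    rewrite <- (Hg 0 t Lt).
    destruct (Lambda_ext (w 0 t) (u' t) Lt ltac:(intros; unfold w; ring)) as (L & <-).
    apply Ad', L. }
  assert (E1 : (m < g 1%R)%nat).
  { destruct (sol_Lambda_time y' (w 1) 0 1 (Sw 1) (Zw 1) ltac:(lra)) as (t & _ & Lt).
    rewrite <- (Hg 1 t Lt).
    destruct (Lambda_ext (w 1 t) (v' t) Lt ltac:(intros; unfold w; ring)) as (L & <-).
    apply Ad', L. }
  lia.
Qed.

(** * Exponential decay of the ratio *)

Lemma ratio_halved : exists T, 0 < T /\ forall y u v, admissible y u v ->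
  ratio u v T <= / 2 * ratio u v 0.
Proof.
  destruct ratio_bound_between as (M & HM & RB).
  apply NNPP; intros C.
  destruct (seq_choice (fun k (p : Y * (R -> nat -> R) * (R -> nat -> R)) =>
    let '(y, u, v) := p in admissible y u v /\
      / 2 * ratio u v 0 < ratio u v (2 * INR (S (S k))))) as (f & Hf).
  { intros k; apply NNPP; intros C'; apply C; exists (2 * INR (S (S k))); split.
    - assert (0 < INR (S (S k))) by (apply lt_0_INR; lia); lra.
    - intros y u v H; apply Rnot_lt_le; intros Hl; apply C'; exists (y, u, v); auto. }
  set (yk := fun k => fst (fst (f k))).
  set (uk := fun k => snd (fst (f k))).
  set (vk := fun k => snd (f k)).
  (* Half of the time at which halving fails; the limit is centred there, so that the controlled
     window grows in both directions. *)
  set (sk := fun k => INR (S (S k))).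
  assert (H : forall k, admissible (yk k) (uk k) (vk k) /\
    / 2 * ratio (uk k) (vk k) 0 < ratio (uk k) (vk k) (2 * sk k)).
  { intros k; specialize (Hf k); unfold yk, uk, vk; destruct (f k) as [[y u] v]; exact Hf. }
  clearbody yk uk vk; clear f Hf C.
  (* For [p], [q] at distance at least [2] from both ends, [ratio p <= M * ratio 0 <= 2 * M * ratio
     (2 * sk k) <= 2 * M ^ 2 * ratio q]. *)
  set (M2 := 2 * M ^ 2).
  assert (HM2 : 0 < M2) by (unfold M2; nra).
  assert (Hs : forall k, sk k = INR k + 2) by (intros k; unfold sk; rewrite !S_INR; ring).
  assert (RB2 : forall k t, Rabs t <= INR k ->
    ratio (uk k) (vk k) (sk k + t) <= M2 * ratio (uk k) (vk k) (sk k) /\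
    ratio (uk k) (vk k) (sk k) <= M2 * ratio (uk k) (vk k) (sk k + t)).
  { intros k t Ht; destruct (H k) as (Ad & Hk).
    assert (Ht' : - INR k <= t <= INR k) by (unfold Rabs in Ht; destruct (Rcase_abs t); lra).
    pose proof (Hs k); pose proof (pos_INR k).
    assert (Q : forall p q, 2 <= p <= 2 * sk k - 2 -> 2 <= q <= 2 * sk k - 2 ->
      ratio (uk k) (vk k) p <= M2 * ratio (uk k) (vk k) q).
    { intros p q Hp Hq.
      pose proof (RB _ _ _ 0 p Ad ltac:(lra)); pose proof (RB _ _ _ q (2 * sk k) Ad ltac:(lra)).
      unfold M2; nra. }
    split; apply Q; lra. }
  (* Here [u] and [v] are normalised separately: the ratio at the centre becomes one, and [M2]
     bounds it from both sides on the window. *)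
  set (a := fun k => / sqrt (sqnorm n (uk k (sk k)))).
  set (b := fun k => / sqrt (sqnorm n (vk k (sk k)))).
  assert (Pos : forall k, 0 < sqnorm n (uk k (sk k)) /\ 0 < sqnorm n (vk k (sk k))).
  { intros k; apply (admissible_pos (yk k)), H. }
  assert (Pab : forall k, 0 < a k /\ 0 < b k /\
    a k ^ 2 = / sqnorm n (uk k (sk k)) /\ b k ^ 2 = / sqnorm n (vk k (sk k))).
  { intros k; destruct (Pos k); unfold a, b; repeat split.
    - apply Rinv_0_lt_compat, sqrt_lt_R0; assumption.
    - apply Rinv_0_lt_compat, sqrt_lt_R0; assumption.
    - rewrite pow_inv, pow2_sqrt; [reflexivity | lra].
    - rewrite pow_inv, pow2_sqrt; [reflexivity | lra]. }
  set (us := fun k t i => a k * uk k (sk k + t) i).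
  set (vs := fun k t i => b k * vk k (sk k + t) i).
  assert (Ad : forall k, admissible (fl (yk k) (sk k)) (us k) (vs k)).
  { intros k; destruct (Pab k) as (Pa & Pb & _); apply admissible_rescale; [lra | lra | apply H]. }
  assert (Nu : forall k, sqnorm n (us k 0) = 1).
  { intros k; destruct (Pab k) as (_ & _ & Ea & _), (Pos k); unfold us.
    rewrite sqnorm_scal, Rplus_0_r, Ea; field; lra. }
  assert (Nv : forall k, sqnorm n (vs k 0) = 1).
  { intros k; destruct (Pab k) as (_ & _ & _ & Eb), (Pos k); unfold vs.
    rewrite sqnorm_scal, Rplus_0_r, Eb; field; lra. }
  assert (Bd : forall k t, Rabs t <= INR k ->
    sqnorm n (vs k t) <= M2 * sqnorm n (us k t) /\ sqnorm n (us k t) <= M2 * sqnorm n (vs k t)).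
  { intros k t Ht; destruct (RB2 k t Ht) as (R1 & R2).
    destruct (Pab k) as (Pa & Pb & Ea & Eb), (Pos k) as (P1 & P2).
    destruct (admissible_pos _ _ _ (sk k + t) (proj1 (H k))) as (P3 & P4).
    unfold us, vs; rewrite !sqnorm_scal, Ea, Eb; unfold ratio in *.
    set (A := sqnorm n (uk k (sk k))) in *; set (D := sqnorm n (vk k (sk k))) in *.
    set (U := sqnorm n (uk k (sk k + t))) in *; set (V := sqnorm n (vk k (sk k + t))) in *.
    split.
    - apply Rmult_le_compat_r with (r := U * / D) in R1.
      2: { apply Rmult_le_pos; [lra | left; apply Rinv_0_lt_compat; lra]. }
      replace (V / U * (U * / D)) with (/ D * V) in R1 by (field; lra).
      replace (M2 * (D / A) * (U * / D)) with (M2 * (/ A * U)) in R1 by (field; lra); exact R1.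
    - apply Rmult_le_compat_r with (r := U * / D) in R2.
      2: { apply Rmult_le_pos; [lra | left; apply Rinv_0_lt_compat; lra]. }
      replace (D / A * (U * / D)) with (/ A * U) in R2 by (field; lra).
      replace (M2 * (V / U) * (U * / D)) with (M2 * (/ D * V)) in R2 by (field; lra); exact R2. }
  destruct (sol_pair_compact (fun k => fl (yk k) (sk k)) us vs 1)
    as (phi & y' & u' & v' & Hphi & Su & Sv & Cu & Cv).
  { intros; apply Ad. }
  { intros; apply Ad. }
  { intros k; rewrite Nu; lra. }
  { intros k; rewrite Nv; lra. }
  assert (One : forall ws w', converges ws w' -> (forall k, sqnorm n (ws k 0) = 1) -> nonzero n (w' 0)).
  { intros ws w' Cw Nw; apply nonzero_sqnorm.
    replace (sqnorm n (w' 0)) with 1; [lra |].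
    apply (UL_sequence (fun k => sqnorm n (ws k 0))).
    - apply (Un_cv_ext (fun _ => 1)); [intros; rewrite Nw; reflexivity | apply Un_cv_const].
    - apply Un_cv_sqnorm; intros; apply Cw; assumption. }
  assert (Lim : forall t, Un_cv (fun k => sqnorm n (us (phi k) t)) (sqnorm n (u' t)) /\
    Un_cv (fun k => sqnorm n (vs (phi k) t)) (sqnorm n (v' t))).
  { intros t; split; apply Un_cv_sqnorm; intros; [apply Cu | apply Cv]; assumption. }
  assert (Ev : forall t, exists N, forall k, (N <= k)%nat -> Rabs t <= INR (phi k)).
  { intros t; destruct (INR_unbounded (Rabs t)) as (N & HN); exists N; intros k Hk.
    assert (INR N <= INR (phi k)) by (apply le_INR; specialize (Hphi k); lia); lra. }
  apply (no_bounded_ratio y' u' v' M2); [| exact HM2 | |].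
  - repeat split; try assumption.
    + apply (One (fun k => us (phi k))); [exact Cu | intros; apply Nu].
    + apply (One (fun k => vs (phi k))); [exact Cv | intros; apply Nv].
    + apply (obeys_limit _ _ u' Cu); intros k; apply (Ad (phi k)).
    + apply (obeys_limit _ _ v' Cv); intros k; apply (Ad (phi k)).
  - intros t; destruct (Lim t) as (Lu & Lv), (Ev t) as (N & HN).
    enough (sqnorm n (v' t) - M2 * sqnorm n (u' t) <= 0) by lra.
    apply (Un_cv_le_limit (fun k => sqnorm n (vs (phi k) t) - M2 * sqnorm n (us (phi k) t))).
    + apply (CV_minus (fun k => sqnorm n (vs (phi k) t))); [exact Lv |].
      apply (CV_mult (fun _ => M2)); [apply Un_cv_const | exact Lu].
    + exists N; intros k Hk; pose proof (proj1 (Bd (phi k) t (HN k Hk))); lra.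
  - intros t; destruct (Lim t) as (Lu & Lv), (Ev t) as (N & HN).
    enough (sqnorm n (u' t) - M2 * sqnorm n (v' t) <= 0) by lra.
    apply (Un_cv_le_limit (fun k => sqnorm n (us (phi k) t) - M2 * sqnorm n (vs (phi k) t))).
    + apply (CV_minus (fun k => sqnorm n (us (phi k) t))); [exact Lu |].
      apply (CV_mult (fun _ => M2)); [apply Un_cv_const | exact Lv].
    + exists N; intros k Hk; pose proof (proj2 (Bd (phi k) t (HN k Hk))); lra.
Qed.

Lemma ratio_decay : exists K nu, 0 < K /\ 0 < nu /\ forall y u v t, admissible y u v -> 0 <= t ->
  ratio u v t <= K * exp (- nu * t) * ratio u v 0.
Proof.
  destruct ratio_halved as (T & HT & Half).
  destruct sol_growth as (c & Hc & G).
  set (E := exp (c * T)).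
  assert (PE : 0 < E) by apply exp_pos.
  set (nu := ln 2 / T).
  assert (Hln : 0 < ln 2) by (rewrite <- ln_1; apply ln_increasing; lra).
  assert (Hnu : 0 < nu) by (apply Rdiv_lt_0_compat; assumption).
  assert (EnuT : exp (- nu * T) = / 2).
  { unfold nu; replace (- (ln 2 / T) * T) with (- ln 2) by (field; lra).
    rewrite exp_Ropp, exp_ln by lra; reflexivity. }
  (* On [[0, T]] one factor [E] bounds the growth of [v] and the other the decay of [u], both for
     squared norms; the [2] makes up for [exp (- nu * t) >= / 2]. *)
  exists (2 * E ^ 2), nu; split; [pose proof (pow_lt E 2 PE); lra |]; split; [exact Hnu |].
  assert (Short : forall y u v t, admissible y u v -> 0 <= t <= T ->
    ratio u v t <= 2 * E ^ 2 * exp (- nu * t) * ratio u v 0).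
  { intros y u v t H Ht.
    destruct (admissible_pos y u v t H) as (P1 & P2), (admissible_pos y u v 0 H) as (P3 & P4).
    pose proof (G y v 0 t ltac:(apply H)) as Gv.
    pose proof (G y u t 0 ltac:(apply H)) as Gu.
    rewrite Rminus_0_r, Rabs_right in Gv by lra.
    rewrite Rminus_0_l, Rabs_Ropp, Rabs_right in Gu by lra.
    assert (Et : exp (c * t) <= E).
    { unfold E; destruct (Rle_lt_or_eq_dec (c * t) (c * T)) as [L| ->].
      - apply Rmult_le_compat_l; lra.
      - left; apply exp_increasing, L.
      - right; reflexivity. }
    assert (En : / 2 <= exp (- nu * t)).
    { rewrite <- EnuT; destruct (Rle_lt_or_eq_dec (- nu * T) (- nu * t)) as [L| ->].
      - nra.
      - left; apply exp_increasing, L.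
      - right; reflexivity. }
    unfold ratio.
    apply Rmult_le_reg_r with (sqnorm n (u t)); [exact P1 |].
    replace (sqnorm n (v t) / sqnorm n (u t) * sqnorm n (u t)) with (sqnorm n (v t)) by (field; lra).
    apply Rle_trans with (E * sqnorm n (v 0)); [nra |].
    assert (U0 : sqnorm n (u 0) <= E * sqnorm n (u t)) by nra.
    replace (2 * E ^ 2 * exp (- nu * t) * (sqnorm n (v 0) / sqnorm n (u 0)) * sqnorm n (u t))
      with ((E * sqnorm n (v 0)) * ((2 * exp (- nu * t)) * (E * sqnorm n (u t) / sqnorm n (u 0))))
      by (field; lra).
    rewrite <- (Rmult_1_r (E * sqnorm n (v 0))) at 1.
    apply Rmult_le_compat_l; [apply Rmult_le_pos; lra |].
    assert (1 <= E * sqnorm n (u t) / sqnorm n (u 0)).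
    { apply Rmult_le_reg_r with (sqnorm n (u 0)); [exact P3 |].
      replace (E * sqnorm n (u t) / sqnorm n (u 0) * sqnorm n (u 0)) with (E * sqnorm n (u t)) by (field; lra).
      lra. }
    nra. }
  (* Peeling off the first interval of length [T] costs [exp (nu * T) = 2], which halving repays
     exactly, so the constant does not grow with [k]. *)
  assert (Ind : forall k y u v t, admissible y u v -> 0 <= t <= INR (S k) * T ->
    ratio u v t <= 2 * E ^ 2 * exp (- nu * t) * ratio u v 0).
  { induction k as [|k IH]; intros y u v t H Ht.
    - apply (Short y); [exact H | simpl in Ht; lra].
    - destruct (Rle_lt_dec t T) as [L|L]; [apply (Short y); [exact H | lra] |].
      pose proof (admissible_rescale y u v 1 1 T ltac:(lra) ltac:(lra) H) as H'.
      rewrite S_INR in Ht.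
      pose proof (IH _ _ _ (t - T) H' ltac:(lra)) as Q.
      rewrite !ratio_shift, Rplus_0_r in Q.
      replace (T + (t - T)) with t in Q by ring.
      replace (1 ^ 2 / 1 ^ 2) with 1 in Q by field.
      rewrite !Rmult_1_l in Q.
      replace (- nu * (t - T)) with (- nu * t + - (- nu * T)) in Q by ring.
      rewrite exp_plus, exp_Ropp, EnuT, Rinv_inv in Q.
      specialize (Half y u v H).
      eapply Rle_trans; [exact Q |].
      assert (0 < E ^ 2 * exp (- nu * t)) by (apply Rmult_lt_0_compat; [apply pow_lt, PE | apply exp_pos]).
      nra. }
  intros y u v t H Ht.
  destruct (INR_unbounded (t / T)) as (k & Hk).
  apply (Ind k y); [exact H |]; split; [exact Ht |].
  apply Rmult_lt_compat_r with (r := T) in Hk; [| exact HT].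
  replace (t / T * T) with t in Hk by (field; lra).
  rewrite S_INR; lra.
Qed.

End System.

(** * Return to the fundamental matrix *)

Lemma in_W_obeys {Y : Type} n (Phi : R -> Y -> nat -> nat -> R) l h y x : in_W n Phi l h y x ->
  vnorm n x = 1 -> obeys n (fun q => (l <= q <= h)%nat) (fun t => mat_vec n (Phi t y) x).
Proof.
  intros [H0|H] Hx; [exfalso | exact H].
  unfold vnorm in Hx.
  rewrite (sumn_ext n _ (fun _ => 0)) in Hx by (intros; rewrite H0 by assumption; ring).
  rewrite sumn_const, Rmult_0_r, sqrt_0 in Hx; lra.
Qed.

Theorem theorem3p3 (Y : Type) (d : Y -> Y -> R) (fl : Y -> R -> Y) (n : nat)
  (B : Y -> nat -> nat -> R) (Phi : R -> Y -> nat -> nat -> R) :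
  is_metric d -> is_compact d -> is_continuous_flow d fl ->
  (forall i j, (i < n)%nat -> (j < n)%nat -> is_continuous_fun d (fun y => B y i j)) ->
  (forall y, tridiag_pos n (B y)) ->
  principal_fundamental_matrix n fl B Phi ->
  forall m : nat, (m + 2 <= n)%nat ->
  exists K nu : R, 0 < K /\ 0 < nu /\
    forall (y : Y) (x1 x2 : nat -> R),
      in_W n Phi 0 m y x1 -> in_W n Phi (S m) (n - 1) y x2 ->
      vnorm n x1 = 1 -> vnorm n x2 = 1 ->
      forall t : R, 0 <= t ->
        vnorm n (mat_vec n (Phi t y) x2) / vnorm n (mat_vec n (Phi t y) x1)
          <= K * exp (- nu * t).
Proof.
  intros Hd Hc Hf HB HT HP m Hm.
  destruct (ratio_decay Y d fl n B Phi Hd Hc Hf HB HP ltac:(lia) HT m) as (K & nu & HK & Hnu & D).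
  (* The ratio is one of squared norms, so constant and rate are those of its square root. *)
  exists (sqrt K), (nu / 2); split; [apply sqrt_lt_R0, HK |]; split; [lra |].
  intros y x1 x2 W1 W2 N1 N2 t Ht.
  set (u := fun t => mat_vec n (Phi t y) x1); set (v := fun t => mat_vec n (Phi t y) x2).
  assert (Sq : forall x, vnorm n x = 1 -> sqnorm n (mat_vec n (Phi 0 y) x) = 1).
  { intros x Hx.
    replace (sqnorm n (mat_vec n (Phi 0 y) x)) with (sqnorm n x).
    - apply sqrt_lem_0 in Hx; [unfold sqnorm; lra | apply sqnorm_nonneg | lra].
    - apply sumn_ext; intros i Hi; rewrite (Phi_0 Y fl n B Phi HP) by exact Hi; reflexivity. }
  assert (Ad : admissible Y fl n B m y u v).
  { repeat split.
    - apply (sol_Phi Y fl n B Phi HP).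
    - apply (sol_Phi Y fl n B Phi HP).
    - apply nonzero_sqnorm; unfold u; rewrite Sq by exact N1; lra.
    - apply nonzero_sqnorm; unfold v; rewrite Sq by exact N2; lra.
    - intros s L; apply (in_W_obeys n Phi 0 m y x1 W1 N1 s L).
    - intros s L; apply (in_W_obeys n Phi (S m) (n - 1) y x2 W2 N2 s L). }
  specialize (D y u v t Ad Ht).
  replace (ratio n u v 0) with 1 in D.
  2: { unfold ratio, u, v; rewrite !Sq by assumption; field. }
  change (sqrt (sqnorm n (v t)) / sqrt (sqnorm n (u t)) <= sqrt K * exp (- (nu / 2) * t)).
  assert (Pu : 0 < sqnorm n (u t)).
  { apply (admissible_pos Y d fl n B Hc Hf HB m y u v t Ad). }
  rewrite <- sqrt_div by (try apply sqnorm_nonneg; exact Pu).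
  replace (exp (- (nu / 2) * t)) with (sqrt (exp (- nu * t))).
  - rewrite <- sqrt_mult by (left; first [exact HK | apply exp_pos]).
    apply sqrt_le_1_alt; unfold ratio in D; lra.
  - replace (- nu * t) with (- (nu / 2) * t + - (nu / 2) * t) by field.
    rewrite exp_plus; apply sqrt_square; left; apply exp_pos.
Qed.
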